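(* Let $n\ge 1$ and let $0<\varepsilon\le L$ be real numbers. If $\varphi$ is a $C^2$ solution on $\mathbb{R}^{n+1}$ of the free wave equation $\Box\varphi = 0$ and $\varphi\equiv 0$ on $\mathcal{H}_{\varepsilon,L}$, then $\varphi\equiv 0$ on $\mathcal{D}_{\varepsilon,L}$.
   Context: Points of $\mathbb{R}^{n+1}$ are written $(t,x)$ with $t\in\mathbb{R}$ and $x=(x_1,\dots,x_n)\in\mathbb{R}^n$. $\mathbb{R}^{n+1}$ carries the standard Minkowski metric, and $\Box = -\partial_t^2 + \sum_{i=1}^n \partial_{x_i}^2$ is the associated wave operator. Let $r=\sqrt{\sum_{i=1}^n x_i^2}$, $u = r+t$ and $v = r-t$. For $0<\varepsilon\le L$, the truncated bifurcate light cone is $$\mathcal{H}_{\varepsilon,L} = \{(t,x)\in\mathbb{R}^{n+1} : r = |t|+1,\ -\varepsilon<t<L\},$$ and $$\mathcal{D}_{\varepsilon,L} = \{(t,x)\in\mathbb{R}^{n+1} : 1<u<2L+1,\ 1<v<1+2\varepsilon\}.$$ *)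

(* Defs.v *)
From HB Require Import structures.
From mathcomp Require Import all_boot all_order all_algebra.
From mathcomp Require Import all_classical all_reals all_analysis.

Set Implicit Arguments.
Unset Strict Implicit.
Unset Printing Implicit Defensive.

Import Order.TTheory GRing.Theory Num.Theory.
Import numFieldNormedType.Exports.

Local Open Scope classical_set_scope.
Local Open Scope ring_scope.

(* The point (t, x) of R^{n+1} is a row vector with coordinate 0 equal to t and
   coordinate i + 1 equal to the i-th coordinate of x.  The norm that the library
   puts on row vectors is the sup norm, so it is used for the topology only, and
   the Euclidean radius r is spelled out. *)
Section Spacetime.
Context {R : realType} {n : nat}.
Implicit Types (p : 'rV[R]_n.+1) (f : 'rV[R]_n.+1 -> R) (eps L : R).

Definition tcoord p : R := p 0 ord0.
Definition xcoord p (i : 'I_n) : R := p 0 (lift ord0 i).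
Definition radius p : R := Num.sqrt (\sum_(i < n) xcoord p i ^+ 2).
Definition ucoord p : R := radius p + tcoord p.
Definition vcoord p : R := radius p - tcoord p.

Definition partial (j : 'I_n.+1) f : 'rV[R]_n.+1 -> R :=
  fun p => 'D_(delta_mx 0 j) f p.

(* 'D_v f p has a junk value where f has no derivative along v, hence the
   explicit derivability requirement. *)
Fixpoint class_C (k : nat) f : Prop :=
  match k with
  | 0 => continuous f
  | k'.+1 => continuous f /\
      forall j : 'I_n.+1,
        (forall p, derivable f p (delta_mx 0 j)) /\ class_C k' (partial j f)
  end.

Definition wave_op f : 'rV[R]_n.+1 -> R := fun p =>
  - partial ord0 (partial ord0 f) p
  + \sum_(i < n) partial (lift ord0 i) (partial (lift ord0 i) f) p.

Definition truncated_cone eps L : set 'rV[R]_n.+1 :=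
  [set p | radius p = `|tcoord p| + 1 /\ - eps < tcoord p < L].

Definition cone_domain eps L : set 'rV[R]_n.+1 :=
  [set p | 1 < ucoord p < 2 * L + 1 /\ 1 < vcoord p < 1 + 2 * eps].

End Spacetime.

(* Main.v *)
Require Import Defs.
From HB Require Import structures.
From mathcomp Require Import all_boot all_order all_algebra.
From mathcomp Require Import all_classical all_reals all_analysis.
From mathcomp Require Import ring lra.
Import Order.TTheory GRing.Theory Num.Theory.
Import numFieldNormedType.Exports.
Local Open Scope classical_set_scope.
Local Open Scope ring_scope.

(* For a unit vector a, the moments M_k(u, v) of phi over the sphere of null
   coordinates (u, v) against (a.x)^k satisfy, with n the space dimension and
   r = (u + v) / 2,
     4 d_u d_v M_k = - (n-1)/r (d_u M_k + d_v M_k)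
                     + k(n+k-2)/r^2 M_k - k(k-1)/r^2 M_(k-2),
   which follows from the wave equation by integration by parts on the sphere.
   They vanish on the characteristic lines u = 1 and v = 1, so by induction on k
   and uniqueness for the Goursat problem they all vanish on D.  Moments in the
   direction a of a continuous function on the sphere determine its value at a. *)

(** * Integration over [-1, 1] *)

(** In null coordinates the wave equation contains the angular Laplacian of [phi], which is not
    controlled by [phi], [d_u phi] and [d_v phi]. A pointwise Goursat iteration would lose two
    angular derivatives at each step, and [phi] is only C^2. Integration against [(a.x)^k] throws
    these derivatives onto the weight, and the spherical Laplacian sends [(a.x)^k] to a combination
    of itself and [(a.x)^(k-2)]. The system is thus triangular in [k] and closes without spherical
    harmonics. The coefficients [1/r] and [1/r^2] are harmless because [u + v > 2] on D. The sphere
    integral only has to be a positive functional that kills rotation derivatives and allows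
    differentiation in a parameter. A cube integral with a radial weight that vanishes on the faces
    has these properties, and they all follow from one-dimensional calculus, with no surface measure
    and no change of variables. *)

Lemma continuous_pair (T U V : topologicalType) (f : T -> U) (g : T -> V) :
  continuous f -> continuous g -> continuous (fun x => (f x, g x)).
Proof. by move=> cf cg x; exact: (cvg_pair (cf x) (cg x)). Qed.

Lemma continuous_compose (T U V : topologicalType) (f : T -> U) (g : U -> V) :
  continuous f -> continuous g -> continuous (fun x => g (f x)).
Proof. by move=> cf cg x; apply: continuous_comp; [exact: cf|exact: cg]. Qed.

Lemma continuous_const (T U : topologicalType) (c : U) : continuous (fun _ : T => c).
Proof. by move=> x; exact: cvg_cst. Qed.

Lemma continuous_ident (T : topologicalType) : continuous (fun x : T => x).
Proof. by move=> x; exact: cvg_id. Qed.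

Lemma continuous_fst (T U : topologicalType) : continuous (fun p : T * U => p.1).
Proof. by move=> p; exact: cvg_fst. Qed.

Lemma continuous_snd (T U : topologicalType) : continuous (fun p : T * U => p.2).
Proof. by move=> p; exact: cvg_snd. Qed.

Section RealValued.
Context {R : realType} (T : topologicalType).
Implicit Types f g : T -> R.

Lemma continuous_add f g :
  continuous f -> continuous g -> continuous (fun x => f x + g x).
Proof. by move=> cf cg x; apply: cvgD; [exact: cf|exact: cg]. Qed.

Lemma continuous_opp f : continuous f -> continuous (fun x => - f x).
Proof. by move=> cf x; apply: cvgN; exact: cf. Qed.

Lemma continuous_mul f g :
  continuous f -> continuous g -> continuous (fun x => f x * g x).
Proof. by move=> cf cg x; apply: cvgM; [exact: cf|exact: cg]. Qed.

Lemma continuous_pow f k : continuous f -> continuous (fun x => f x ^+ k).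
Proof.
move=> cf; elim: k => [|k IH].
  by under eq_fun do rewrite expr0; exact: continuous_const.
by under eq_fun do rewrite exprS; exact: continuous_mul.
Qed.

Lemma continuous_sum (I : Type) (r : seq I) (F : I -> T -> R) :
  (forall i, continuous (F i)) -> continuous (fun x => \sum_(i <- r) F i x).
Proof.
move=> cF; elim: r => [|i r IH].
  by under eq_fun do rewrite big_nil; exact: continuous_const.
by under eq_fun do rewrite big_cons; exact: continuous_add.
Qed.

End RealValued.

Section OneVariable.
Context {R : realType}.
Implicit Types (f g F G : R -> R) (a b : R).

Lemma is_derive_continuous f (x d : R) : is_derive x 1 f d -> {for x, continuous f}.
Proof.
by move=> [df _]; apply/differentiable_continuous/derivable1_diffP.
Qed.

Lemma mean_value f (df : R -> R) a b : a < b ->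
  (forall x : R, a <= x <= b -> is_derive x 1 f (df x)) ->
  exists2 c, a < c < b & f b - f a = df c * (b - a).
Proof.
move=> ab dF; have [||c cab fE] := @MVT R f df a b ab.
- by move=> x; rewrite in_itv /= => /andP[ax xb]; apply: dF; rewrite !ltW.
- apply: derivable_within_continuous => x; rewrite in_itv /= => xab.
  by have [] := dF _ xab.
- by exists c => //; move: cab; rewrite in_itv.
Qed.

Definition int11 f : R := \int[lebesgue_measure]_(x in `[-1, 1]) f x.

(** Linearity, sign and mean value of [int11] all go through a primitive, so that they reduce to
    differential calculus. *)
Lemma int11_primitive f F : continuous f ->
  (forall x : R, -1 <= x <= 1 -> is_derive x 1 F (f x)) -> int11 f = F 1 - F (-1).
Proof.
move=> cf dF; rewrite /int11 /Rintegral (@continuous_FTC2 _ f F) //.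
- exact: continuous_subspaceT.
- split.
  + by move=> x; rewrite in_itv /= => xI; have [] : is_derive x 1 F (f x) by apply: dF; lra.
  + apply: cvg_at_right_filter; apply: is_derive_continuous; apply: dF; lra.
  + apply: cvg_at_left_filter; apply: is_derive_continuous; apply: dF; lra.
- move=> x; rewrite in_itv /= => xI.
  by rewrite derive1E; have [_] : is_derive x 1 F (f x) by apply: dF; lra.
Qed.

Lemma primitive_ex f : continuous f ->
  exists F, forall x : R, -1 <= x <= 1 -> is_derive x 1 F (f x).
Proof.
(* The base point [-2] and the bound 2 below leave room around [[-1, 1]], so that the derivative is
   two-sided at the endpoints too. *)
move=> cf; exists (fun x => \int[lebesgue_measure]_(t in `[-2, x]) f t) => x xI.
have [||||] := @continuous_FTC1 _ f (BLeft (-2)) x 2.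
- lra.
- apply: continuous_compact_integrable; first exact: segment_compact.
  exact: continuous_subspaceT.
- rewrite lte_fin; lra.
- exact: cf.
- by move=> dF FE; split => //; rewrite -derive1E.
Qed.

(** The mean value theorem for a primitive; 2 is the length of the interval. Bounding an integral
    thereby becomes bounding one value of the integrand. *)
Lemma int11_mean f : continuous f ->
  exists2 c, -1 <= c <= 1 & int11 f = 2 * f c.
Proof.
move=> cf; have [F dF] := primitive_ex _ cf.
rewrite (int11_primitive _ _ cf dF).
have N11 : -1 < 1 :> R by lra.
have [c cI ->] := mean_value _ _ _ _ N11 dF.
by exists c; lra.
Qed.

Lemma int11D f g : continuous f -> continuous g ->
  int11 (fun x => f x + g x) = int11 f + int11 g.
Proof.
move=> cf cg.
have [F dF] := primitive_ex _ cf; have [G dG] := primitive_ex _ cg.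
rewrite (int11_primitive _ _ cf dF) (int11_primitive _ _ cg dG).
transitivity (F 1 + G 1 - (F (-1) + G (-1))); last lra.
apply: (int11_primitive _ (fun x => F x + G x)).
- by move=> x; apply: cvgD; [exact: cf|exact: cg].
- by move=> x xI; apply: is_deriveD; [exact: dF|exact: dG].
Qed.

Lemma int11Z a f : continuous f -> int11 (fun x => a * f x) = a * int11 f.
Proof.
move=> cf; have [F dF] := primitive_ex _ cf.
rewrite (int11_primitive _ _ cf dF).
transitivity (a * F 1 - a * F (-1)); last lra.
apply: (int11_primitive _ (fun x => a * F x)).
- by move=> x; apply: cvgM; [exact: cvg_cst|exact: cf].
- by move=> x xI; apply: is_deriveZ; exact: dF.
Qed.

Lemma int11_ge0 f : continuous f -> (forall x, 0 <= f x) -> 0 <= int11 f.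
Proof.
by move=> cf f0; have [c _ ->] := int11_mean _ cf; rewrite mulr_ge0.
Qed.

(** If the integral were 0, the nondecreasing primitive would have equal end values and be constant,
    so its derivative [f a] at the interior point [a] would be 0. *)
Lemma int11_gt0 f a : continuous f -> (forall x, 0 <= f x) ->
  -1 < a < 1 -> 0 < f a -> 0 < int11 f.
Proof.
move=> cf f0 aI fa; rewrite lt_neqAle int11_ge0 // andbT eq_sym.
apply/eqP => int0; have [F dF] := primitive_ex _ cf.
move: int0; rewrite (int11_primitive _ _ cf dF) => F01.
have Fmono x y : -1 <= x -> x < y -> y <= 1 -> F x <= F y.
  move=> x1 xy y1; have [|c cI E] := @mean_value F f x y xy.
    by move=> z zI; apply: dF; lra.
  by rewrite -subr_ge0 E mulr_ge0 // subr_ge0 ltW.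
have Fcst x : -1 < x < 1 -> F x = F (-1).
  by move=> xI; have := Fmono (-1) x; have := Fmono x 1; lra.
have [_] : is_derive a 1 F (f a) by apply: dF; lra.
have -> : 'D_1 F a = 'D_1 (cst (F (-1))) a.
  apply: near_eq_derive.
  have : \forall x \near a, x \in `]-1, 1[ by apply: near_in_itvoo; rewrite in_itv.
  by apply: filterS => x; rewrite in_itv /= => /Fcst.
by rewrite derive_cst => E; move: fa; rewrite -E ltxx.
Qed.

(** Compactness of [[-1, 1]] makes the continuity in [t] uniform in [x]. Near each [x], both
    [F t' x'] and [F t x'] are compared with [F t x], whence [e / 2]. *)
Lemma tube_lemma (T : topologicalType) (F : T -> R -> R) (t : T) (e : R) :
  continuous (fun p : T * R => F p.1 p.2) -> 0 < e ->
  \forall t' \near t, forall x, -1 <= x <= 1 -> `|F t' x - F t x| < e.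
Proof.
move=> cF e0.
have /compact_near_coveringP := @segment_compact R (-1) 1.
move=> /(_ T (nbhs t) (fun t' x => `|F t' x - F t x| < e) _) H.
have : \forall t' \near t, `[-1, 1]%classic `<=` (fun x => `|F t' x - F t x| < e).
  apply: H => x _.
  have e2 : 0 < e / 2 by rewrite divr_gt0.
  have /cvgrPdist_lt /(_ _ e2) [/= [A B] [/= tA xB] AB] := cF (t, x).
  near=> x' t' => /=.
  have At : A t by exact: nbhs_singleton.
  have Bx' : B x' by near: x'.
  have At' : A t' by near: t'.
  have /= := AB (t', x') (conj At' Bx'); have /= := AB (t, x') (conj At Bx').
  move=> h1 h2.
  rewrite (_ : F t' x' - F t x' = (F t x - F t x') - (F t x - F t' x')); last lra.
  by rewrite (le_lt_trans (ler_normB _ _)) // (splitr e) ltrD.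
by apply: filterS => t' sub x xI; apply: sub => /=; rewrite in_itv.
Unshelve. all: by end_near.
Qed.

Lemma continuous_slice (T : topologicalType) (F : T -> R -> R) t :
  continuous (fun p : T * R => F p.1 p.2) -> continuous (F t).
Proof.
move=> cF x.
apply: (@continuous_comp _ _ _ (fun x => (t, x)) (fun p => F p.1 p.2)); last exact: cF.
by apply: continuous_pair; [exact: continuous_const|exact: continuous_ident].
Qed.

Lemma int11_continuous (T : topologicalType) (F : T -> R -> R) :
  continuous (fun p : T * R => F p.1 p.2) -> continuous (fun t => int11 (F t)).
Proof.
move=> cF t; apply/cvgrPdist_lt => e e0.
have e2 : 0 < e / 2 by rewrite divr_gt0.
have cs t' := continuous_slice _ _ t' cF.
apply: filterS (tube_lemma _ _ t _ cF e2) => t' sub.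
rewrite -(mulN1r (int11 (F t'))) -int11Z // -int11D //; last first.
  by move=> x; apply: cvgM; [exact: cvg_cst|exact: cs].
have [|c cI ->] := @int11_mean (fun x => F t x + -1 * F t' x).
  by move=> x; apply: cvgD; [exact: cs|apply: cvgM; [exact: cvg_cst|exact: cs]].
have := sub _ cI; rewrite distrC mulN1r => h.
rewrite normrM ger0_norm //; lra.
Qed.

(** Leibniz' rule with two mean values in place of dominated convergence: the error is the integral
    of a continuous [g], hence [2 * g c] for some [c]. At this [c] the difference quotient in [t] is
    [dF s c] with [s] close to [t], and [tube_lemma] bounds [dF t c - dF s c] uniformly in [c]. *)
Lemma int11_derive (F dF : R -> R -> R) :
  continuous (fun p : R * R => dF p.1 p.2) -> (forall t, continuous (F t)) ->
  (forall t x : R, is_derive t 1 (F^~ x) (dF t x)) ->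
  forall t : R, is_derive t 1 (fun t => int11 (F t)) (int11 (dF t)).
Proof.
move=> cdF cF dFF t.
have cdFs t' := continuous_slice _ _ t' cdF.
suff lim : (fun h : R => h^-1 *: (int11 (F (h *: 1 + t)) - int11 (F t))) @ 0^' --> int11 (dF t).
  by split; [apply/cvg_ex; eexists; exact: lim|apply: cvg_lim => //; exact: lim].
apply/cvgrPdist_lt => e e0.
have e2 : 0 < e / 2 by rewrite divr_gt0.
have [d /= d0 sub] : exists2 d : R, 0 < d & forall t', `|t - t'| < d ->
    forall x, -1 <= x <= 1 -> `|dF t' x - dF t x| < e / 2.
  by have /nbhs_ballP[d /= d0 H] := tube_lemma _ _ t _ cdF e2; exists d.
near=> h.
have h0 : h != 0 by near: h; exact: nbhs_dnbhs_neq.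
have hd : `|h| < d by near: h; exact: dnbhs0_lt.
pose g x := dF t x + - h^-1 * (F (h *: 1 + t) x + -1 * F t x).
have cd : continuous (fun x => F (h *: 1 + t) x + -1 * F t x).
  by move=> x; apply: cvgD; [exact: cF|apply: cvgM; [exact: cvg_cst|exact: cF]].
have cdh : continuous (fun x => - h^-1 * (F (h *: 1 + t) x + -1 * F t x)).
  by move=> x; apply: cvgM; [exact: cvg_cst|exact: cd].
have -> : int11 (dF t) - h^-1 *: (int11 (F (h *: 1 + t)) - int11 (F t)) = int11 g.
  rewrite int11D // int11Z // int11D //; last first.
    by move=> x; apply: cvgM; [exact: cvg_cst|exact: cF].
  by rewrite int11Z // /GRing.scale /= mulN1r mulNr.
have [|c cI ->] := @int11_mean g.
  by move=> x; apply: cvgD; [exact: cdFs|exact: cdh].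
suff [s sd gE] : exists2 s, `|t - s| < d & g c = dF t c - dF s c.
  have := sub _ sd _ cI; rewrite distrC -gE normrM ger0_norm //; lra.
have hE : h *: 1 + t = t + h by rewrite /GRing.scale /= mulr1 addrC.
have [hp|hn|hz] := ltgtP 0 h; last by rewrite -hz eqxx in h0.
- have tth : t < t + h by lra.
  have [s sI E] := mean_value (F^~ c) (dF^~ c) _ _ tth (fun z _ => dFF z c).
  exists s; first by move: hd; rewrite gtr0_norm // ltr_norml => hd; lra.
  by rewrite /g hE mulN1r E; field.
- have tht : t + h < t by lra.
  have [s sI E] := mean_value (F^~ c) (dF^~ c) _ _ tht (fun z _ => dFF z c).
  exists s; first by move: hd; rewrite ltr0_norm // ltr_norml => hd; lra.
  rewrite /g hE mulN1r -(opprB (F t c)) E; field.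
Unshelve. all: by end_near.
Qed.

End OneVariable.

(** * Functions of several variables *)

Section Differentiability.
Context {R : realType}.

Lemma small_positive (d : R) : 0 < d -> exists2 s : R, 0 < s & `|s| + `|s| < d.
Proof. by move=> d0; exists (d / 4); rewrite ?gtr0_norm; lra. Qed.

Lemma subr_swap (a b c d : R) : a - b - (c - d) = a - c - (b - d).
Proof. by lra. Qed.

Lemma eq_of_close (x y : R) :
  (forall e : R, 0 < e -> exists z, `|x - z| < e /\ `|y - z| < e) -> x = y.
Proof.
move=> H; apply/eqP; rewrite -subr_eq0 -normr_le0 leNgt; apply/negP => xy0.
have [z [xz yz]] := H (`|x - y| / 2) (divr_gt0 xy0 (ltr0Sn _ _)).
have := ler_distD z x y; rewrite (distrC z y) => h; lra.
Qed.

Lemma mean_value0 (f df : R -> R) (s : R) :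
  (forall x : R, is_derive x 1 f (df x)) ->
  exists2 c, `|c| <= `|s| & f s - f 0 = s * df c.
Proof.
move=> dF; have [sp|sn|<-] := ltgtP 0 s; last first.
- by exists 0; rewrite // mul0r subrr.
- have [c cI E] := mean_value f df s 0 sn (fun z _ => dF z).
  exists c; last by rewrite -(opprB (f 0)) E; lra.
  by rewrite !ltr0_norm //; lra.
- have [c cI E] := mean_value f df 0 s sp (fun z _ => dF z).
  exists c; last by rewrite E; lra.
  by rewrite !gtr0_norm //; lra.
Qed.

Lemma is_derive_line (V W : normedModType R) (f : V -> W) (p v : V) (d : W) (t : R) :
  is_derive (p + t *: v) v f d -> is_derive t 1 (fun t => f (p + t *: v)) d.
Proof.
have E : (fun h : R => h^-1 *: (f (p + (h *: (1 : R) + t) *: v) - f (p + t *: v)))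
    = (fun h : R => h^-1 *: (f (h *: v + (p + t *: v)) - f (p + t *: v))).
  apply/funext => h; congr (_ *: (f _ - _)).
  by rewrite [h *: 1]mulr1 scalerDl addrCA.
move=> [df dE]; split.
- by rewrite /derivable /comp /= E.
- by rewrite -dE /derive /comp /= E.
Qed.

Lemma is_derive_line0 (V W : normedModType R) (f : V -> W) (p v : V) (d : W) :
  is_derive (0 : R) 1 (fun t : R => f (p + t *: v)) d -> is_derive p v f d.
Proof.
have E : (fun h : R => h^-1 *: (f (p + (h *: (1 : R) + 0) *: v) - f (p + 0 *: v)))
    = (fun h : R => h^-1 *: (f (h *: v + p) - f p)).
  apply/funext => h; rewrite scale0r !addr0; congr (_ *: (f _ - _)).
  by rewrite [h *: 1]mulr1 addrC.
move=> [df dE]; split.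
- by move: df; rewrite /derivable /comp /= E.
- by rewrite -dE /derive /comp /= E.
Qed.

Lemma class_C_continuous k n (f : 'rV[R]_n.+1 -> R) : class_C k f -> continuous f.
Proof. by case: k => [|k] // []. Qed.

Lemma class_C_pred k n (f : 'rV[R]_n.+1 -> R) : class_C k.+1 f -> class_C k f.
Proof.
elim: k f => [|k IH] f [cf H]; first exact: cf.
by split=> // j; have [? /IH] := H j.
Qed.

Section Fixed_dimension.
Context {n : nat}.
Implicit Types (f g : 'rV[R]_n.+1 -> R) (p h v : 'rV[R]_n.+1).
Local Notation e_ j := (delta_mx 0 j : 'rV[R]_n.+1).

Lemma class_C_partial k f j : class_C k.+1 f -> class_C k (partial j f).
Proof. by case=> _ /(_ j)[]. Qed.

Lemma class_C1_is_derive f j p : class_C 1 f ->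
  is_derive p (e_ j) f (partial j f p).
Proof. by move=> [_ /(_ j)[df _]]; apply: DeriveDef. Qed.

Lemma class_C1_intro f (df : 'I_n.+1 -> 'rV[R]_n.+1 -> R) : continuous f ->
  (forall j p, is_derive p (e_ j) f (df j p)) -> (forall j, continuous (df j)) ->
  class_C 1 f.
Proof.
move=> cf dfE cdf; split=> // j; split=> [p|]; first by case: (dfE j p).
by rewrite /= (_ : partial j f = df j) //; apply/funext => p; case: (dfE j p).
Qed.

Lemma partial_mean_value f j p (s : R) : class_C 1 f ->
  exists2 c, `|c| <= `|s| & f (p + s *: e_ j) - f p = s * partial j f (p + c *: e_ j).
Proof.
move=> C1f.
have [|c cs E] := mean_value0 (fun t => f (p + t *: e_ j))
  (fun t => partial j f (p + t *: e_ j)) s.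
  by move=> t; apply: is_derive_line; exact: class_C1_is_derive.
by exists c => //; rewrite -E scale0r addr0.
Qed.

Lemma row_norm_le p (M : R) : 0 <= M -> (forall j, `|p 0 j| <= M) -> `|p| <= M.
Proof.
move=> M0 H; rewrite /Num.norm /= mx_normrE.
by apply: bigmax_le => // -[i j] _ /=; rewrite ord1.
Qed.

Lemma row_coord_le p j : `|p 0 j| <= `|p|.
Proof.
by rewrite [leRHS]/Num.norm /= mx_normrE; apply: (le_bigmax _ (fun i => `|p i.1 i.2|) (0, j)).
Qed.

(** The corners of the staircase from 0 to [h] that changes one coordinate at a time. *)
Definition row_take (k : nat) h : 'rV[R]_n.+1 :=
  \row_j (if (j < k)%N then h 0 j else 0).

(** The increment telescopes along the staircase, and each step is a one-variable mean value. In the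
    sup norm the intermediate points stay within [|h|] of [p], where each partial derivative varies
    by less than [e / (n + 1)]. *)
Lemma class_C1_increment f p (e : R) : class_C 1 f -> 0 < e ->
  \forall h \near (0 : 'rV[R]_n.+1),
    `|f (p + h) - f p - \sum_j h 0 j * partial j f p| <= e * `|h|.
Proof.
move=> C1f e0; pose e' := e / n.+1%:R.
have e'0 : 0 < e' by rewrite divr_gt0 // ltr0n.
have [d d0 dP] : exists2 d : R, 0 < d & forall h j, `|h| < d ->
    `|partial j f (p + h) - partial j f p| < e'.
  have : \forall q \near p, forall j : 'I_n.+1,
      `|partial j f q - partial j f p| < e'.
    apply: (@filter_forall _ _ (fun j q => `|partial j f q - partial j f p| < e') (nbhs p) (nbhs_filter p)) => j.
    have cj : {for p, continuous (partial j f)} by case: C1f => _ /(_ j)[_]; exact.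
    move/cvgrPdist_lt : cj => /(_ _ e'0).
    by apply: filterS => q; rewrite distrC.
  move=> /nbhs_ballP[d /= d0 H]; exists d => // h j hd.
  by apply: H; rewrite -ball_normE /= opprD addNKr normrN.
apply/nbhs_ballP; exists d => //= h; rewrite -ball_normE /= sub0r normrN => hd.
have stepE (j : 'I_n.+1) : row_take j.+1 h = row_take j h + h 0 j *: e_ j.
  apply/rowP => i; rewrite !mxE eqxx /= ltnS leq_eqVlt.
  have [<-|ij] := eqVneq j i; first by rewrite eqxx ltnn /= mulr1 add0r.
  by rewrite mulr0 addr0 eq_sym (negbTE (_ : val j != val i)).
have -> : f (p + h) - f p =
    \sum_(j < n.+1) (f (p + row_take j.+1 h) - f (p + row_take j h)).
  rewrite -(big_mkord xpredT (fun j => f (p + row_take j.+1 h) - f (p + row_take j h))).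
  rewrite telescope_sumr //; congr (f (p + _) - f _).
    by apply/rowP => j; rewrite mxE ltn_ord.
  by rewrite (_ : row_take 0 h = 0) ?addr0 //; apply/rowP => j; rewrite !mxE.
rewrite -sumrB; apply: (le_trans (ler_norm_sum _ _ _)).
have -> : e * `|h| = \sum_(j < n.+1) `|h| * e'.
  by rewrite sumr_const card_ord /e' -[RHS]mulr_natr -mulrA divfK ?pnatr_eq0 // mulrC.
apply: ler_sum => j _; rewrite stepE addrA.
have [c ch ->] := partial_mean_value f j (p + row_take j h) (h 0 j) C1f.
rewrite -mulrBr normrM ler_pM //; first exact: row_coord_le.
rewrite -addrA ltW // dP //; apply: le_lt_trans hd.
apply: row_norm_le => // i; rewrite !mxE eqxx /=.
have [<-|ij] := eqVneq j i.
  by rewrite ltnn mulr1 add0r (le_trans ch) // row_coord_le.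
by rewrite mulr0 addr0; case: ifP => _; rewrite ?normr0 // row_coord_le.
Qed.

Lemma row_coord_continuous j : continuous (fun h => h 0 j).
Proof. exact: coord_continuous. Qed.

Lemma row_dot_continuous (a : 'I_n.+1 -> R) : continuous (fun h => \sum_j h 0 j * a j).
Proof.
apply: continuous_sum => j; apply: continuous_mul; last exact: continuous_const.
exact: row_coord_continuous.
Qed.

Lemma class_C1_diff f p : class_C 1 f ->
  differentiable f p /\ forall v, 'd f p v = \sum_j v 0 j * partial j f p.
Proof.
move=> C1f.
have lin : linear (fun h => \sum_j h 0 j * partial j f p : R^o).
  move=> k x y; rewrite scaler_sumr -big_split /=; apply: eq_bigr => j _.
  by rewrite !mxE mulrDl -mulrA.
pose linM := GRing.isLinear.Build _ _ _ _ _ lin.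
pose D : {linear 'rV[R]_n.+1 -> R^o} := HB.pack (fun h => \sum_j h 0 j * partial j f p : R^o) linM.
have cD : continuous (D : 'rV[R]_n.+1 -> R) by exact: row_dot_continuous.
have fD : f \o shift p = cst (f p) + D +o_ (0 : 'rV[R]_n.+1) id.
  apply/eqaddoP => e e0; have := class_C1_increment f p e C1f e0.
  by apply: filterS => h; rewrite /= !fctE /= opprD addrA (addrC h).
have dfE : 'd f p = D :> ('rV[R]_n.+1 -> R) by exact: diff_unique.
split; last by move=> v; rewrite dfE.
by apply/diff_locallyP; rewrite dfE.
Qed.

(** Since [c] is only derivable along [v], the chain rule is applied to the curve [g] in one real
    variable, where derivability is differentiability; [class_C1_diff] supplies the differential of
    [f]. *)
Lemma is_derive_comp (V : normedModType R) (c : V -> 'rV[R]_n.+1)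
    (c' : 'rV[R]_n.+1) f (t v : V) : class_C 1 f ->
  (forall j, is_derive t v (fun t => c t 0 j) (c' 0 j)) ->
  is_derive t v (f \o c) (\sum_j c' 0 j * partial j f (c t)).
Proof.
move=> C1f cE.
have dc : derivable c t v.
  by apply/derivable_mxP => i j; rewrite ord1; case: (cE j).
have c'E : 'D_v c t = c'.
  by apply/rowP => j; rewrite derive_mx // mxE; case: (cE j).
pose g (s : R) := c (t + s *: v).
have dg : is_derive (0 : R) 1 g c'.
  by apply: is_derive_line; rewrite scale0r addr0; split.
have [/derivable1_diffP dg0 g'E] := dg.
have g0 : g 0 = c t by rewrite /g scale0r addr0.
have [df dfE] := class_C1_diff f (g 0) C1f.
apply: is_derive_line0; rewrite -/(f \o g).
split.
  by apply/derivable1_diffP/differentiable_comp.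
rewrite deriveE; last exact: differentiable_comp.
by rewrite diff_comp //= -[X in 'd f _ X]deriveE // (_ : 'D_1 g 0 = c') // dfE g0.
Qed.

(** The mean value theorem is used once along [e_ i], on the difference [g] of two lines, and once
    along [e_ j]; each use moves the point by at most [|s|]. *)
Lemma mixed_difference f (i j : 'I_n.+1) p (s : R) : class_C 2 f ->
  exists q, `|q - p| <= `|s| + `|s| /\
    f (p + (s *: e_ i + s *: e_ j)) - f (p + s *: e_ i) - (f (p + s *: e_ j) - f p)
      = s * s * partial j (partial i f) q.
Proof.
move=> C2f; have C1f := class_C_pred _ _ _ C2f.
have C1i := class_C_partial _ _ i C2f.
pose g (t : R) := f (p + s *: e_ j + t *: e_ i) - f (p + t *: e_ i).
have dg (t : R) : is_derive t 1 g
    (partial i f (p + s *: e_ j + t *: e_ i) - partial i f (p + t *: e_ i)).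
  by apply: is_deriveB; apply: is_derive_line; exact: class_C1_is_derive.
have [x xs E] := mean_value0 g _ s dg.
have [y ys E'] := partial_mean_value (partial i f) j (p + x *: e_ i) s C1i.
exists (p + x *: e_ i + y *: e_ j); split.
  rewrite addrC !addrA addNr add0r (le_trans (ler_normD _ _)) //.
  have norm_e k (z : R) : `|z| <= `|s| -> `|z *: e_ k| <= `|s|.
    move=> zs; apply: row_norm_le => // l; rewrite !mxE eqxx /=.
    by case: (_ == _); rewrite ?mulr1 ?mulr0 ?normr0.
  by rewrite lerD // norm_e.
move: E; rewrite /g !scale0r !addr0 !(addrAC p (s *: e_ j)) => E.
by rewrite addrA -mulrA -E' -E.
Qed.

(** Schwarz' theorem: the second difference is symmetric in [i] and [j], so the two mixed
    derivatives agree at two points arbitrarily close to [p], and both are continuous. *)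
Lemma partial_commute f (i j : 'I_n.+1) : class_C 2 f ->
  partial i (partial j f) = partial j (partial i f).
Proof.
move=> C2f.
have C0 k l : continuous (partial k (partial l f)).
  exact: (class_C_partial 0 _ k (class_C_partial 1 _ l C2f)).
apply/funext => p; apply: eq_of_close => e e0.
have [d d0 dP] : exists2 d : R, 0 < d & forall q, `|q - p| < d ->
    `|partial i (partial j f) p - partial i (partial j f) q| < e /\
    `|partial j (partial i f) p - partial j (partial i f) q| < e.
  have /cvgrPdist_lt /(_ _ e0) /nbhs_ballP[d1 /= d10 H1] := C0 i j p.
  have /cvgrPdist_lt /(_ _ e0) /nbhs_ballP[d2 /= d20 H2] := C0 j i p.
  exists (Num.min d1 d2) => [|q]; first by rewrite lt_min d10.
  rewrite lt_min => /andP[q1 q2].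
  by split; [apply: H1|apply: H2]; rewrite -ball_normE /= distrC.
have [s4 s0 sd] : exists2 s : R, 0 < s & `|s| + `|s| < d.
  exact: small_positive.
have [q [qp E]] := mixed_difference f i j p s4 C2f.
have [q' [q'p E']] := mixed_difference f j i p s4 C2f.
have qq' : partial j (partial i f) q = partial i (partial j f) q'.
  apply: (mulfI (_ : s4 * s4 != 0)); first by rewrite gt_eqF // mulr_gt0.
  by rewrite -E -E' (addrC (s4 *: e_ i)); exact: subr_swap.
exists (partial j (partial i f) q); split.
  by rewrite qq'; have [] := dP q' (le_lt_trans q'p sd).
by have [] := dP q (le_lt_trans qp sd).
Qed.

End Fixed_dimension.
End Differentiability.
(** * Iterated integrals over a cube *)

Lemma continuous_addZ {R : realType} (T : topologicalType) m (f : T -> 'rV[R]_m)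
    (s : T -> R) (v : 'rV[R]_m) :
  continuous f -> continuous s -> continuous (fun t => f t + s t *: v).
Proof.
by move=> cf cs t; apply: cvgD; [exact: cf|apply: cvgZr_tmp; exact: cs].
Qed.

Section BoxIntegral.
Context {R : realType} {n : nat}.
Implicit Types (F G : 'rV[R]_n.+1 -> R) (y z v : 'rV[R]_n.+1) (l : seq 'I_n.+1).
Local Notation e_ j := (delta_mx 0 j : 'rV[R]_n.+1).

(** The argument of [F] is [y] with coordinate [j] replaced by [x]. The result stays a function on
    the whole space, constant in coordinate [j], so slices iterate without a change of dimension. *)
Definition slice_int (j : 'I_n.+1) F y : R :=
  int11 (fun x => F (y + (x - y 0 j) *: e_ j)).

Definition slices_int l F : 'rV[R]_n.+1 -> R := foldr slice_int F l.

(* The base point 0 is irrelevant by [slices_int_agree]. *)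
Definition box_int F : R := slices_int (enum 'I_n.+1) F 0.

Lemma continuous_curry_slice (T : topologicalType) (F : T -> 'rV[R]_n.+1 -> R) t :
  continuous (fun p : T * 'rV[R]_n.+1 => F p.1 p.2) -> continuous (F t).
Proof.
move=> cF; apply: (continuous_compose _ _ _ (fun y => (t, y)) _ _ cF).
by apply: continuous_pair; [exact: continuous_const|exact: continuous_ident].
Qed.

(** The parameter is kept because Leibniz' rule, applied to one layer, asks for joint continuity of
    the layers inside it. *)
Lemma slice_int_continuous2 (T : topologicalType) j (F : T -> 'rV[R]_n.+1 -> R) :
  continuous (fun p : T * 'rV[R]_n.+1 => F p.1 p.2) ->
  continuous (fun p : T * 'rV[R]_n.+1 => slice_int j (F p.1) p.2).
Proof.
move=> cF; apply: (int11_continuous _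
  (fun (p : T * 'rV[R]_n.+1) x => F p.1 (p.2 + (x - p.2 0 j) *: e_ j))).
pose g (q : T * 'rV[R]_n.+1 * R) := (q.1.1, q.1.2 + (q.2 - q.1.2 0 j) *: e_ j).
apply: (continuous_compose _ _ _ g _ _ cF).
have c1 : continuous (fun q : T * 'rV[R]_n.+1 * R => q.1) by exact: continuous_fst.
apply: continuous_pair.
  exact: (continuous_compose _ _ _ _ _ c1 (continuous_fst _ _)).
have c12 := continuous_compose _ _ _ _ _ c1 (continuous_snd _ _).
apply: continuous_addZ => //; apply: continuous_add; first exact: continuous_snd.
apply: continuous_opp.
exact: (continuous_compose _ _ _ _ _ c12 (row_coord_continuous j)).
Qed.

Lemma slices_int_continuous2 (T : topologicalType) l (F : T -> 'rV[R]_n.+1 -> R) :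
  continuous (fun p : T * 'rV[R]_n.+1 => F p.1 p.2) ->
  continuous (fun p : T * 'rV[R]_n.+1 => slices_int l (F p.1) p.2).
Proof.
move=> cF; elim: l => [//|j l IH].
exact: (slice_int_continuous2 _ _ (fun t => slices_int l (F t))).
Qed.

Lemma slices_int_continuous l F : continuous F -> continuous (slices_int l F).
Proof.
move=> cF; apply: (continuous_curry_slice R (fun _ => slices_int l F) 0).
apply: (slices_int_continuous2 R l (fun _ => F)).
exact: (continuous_compose _ _ _ _ _ (continuous_snd _ _) cF).
Qed.

Lemma continuous_on_line F y (s : R -> R) v :
  continuous F -> continuous s -> continuous (fun x => F (y + s x *: v)).
Proof.
move=> cF cs; apply: (continuous_compose _ _ _ _ _ _ cF).
by apply: continuous_addZ => //; exact: continuous_const.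
Qed.

Lemma slice_continuous F y j :
  continuous F -> continuous (fun x => F (y + (x - y 0 j) *: e_ j)).
Proof.
move=> cF; apply: continuous_on_line => //.
by apply: continuous_add; [exact: continuous_ident|exact: continuous_const].
Qed.

Lemma slices_intD l F G y : continuous F -> continuous G ->
  slices_int l (fun y => F y + G y) y = slices_int l F y + slices_int l G y.
Proof.
move=> cF cG; elim: l y => [//|j l IH] y /=; rewrite /slice_int -int11D.
- by congr int11; apply/funext => x.
- exact/slice_continuous/slices_int_continuous.
- exact/slice_continuous/slices_int_continuous.
Qed.

Lemma slices_intZ l (a : R) F y : continuous F ->
  slices_int l (fun y => a * F y) y = a * slices_int l F y.
Proof.
move=> cF; elim: l y => [//|j l IH] y /=; rewrite /slice_int -int11Z.
- by congr int11; apply/funext => x.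
- exact/slice_continuous/slices_int_continuous.
Qed.

Lemma slices_int_ge0 l F y : continuous F -> (forall y, 0 <= F y) ->
  0 <= slices_int l F y.
Proof.
move=> cF F0; elim: l y => [//|j l IH] y /=; apply: int11_ge0 => [|x]; last exact: IH.
exact/slice_continuous/slices_int_continuous.
Qed.

Lemma slices_int_gt0 l F y : continuous F -> (forall y, 0 <= F y) ->
  (forall j, -1 < y 0 j < 1) -> 0 < F y -> 0 < slices_int l F y.
Proof.
move=> cF F0 yI Fy; elim: l => [//|j l IH] /=; apply: (int11_gt0 _ (y 0 j)).
- exact/slice_continuous/slices_int_continuous.
- by move=> x; exact: slices_int_ge0.
- exact: yI.
- by rewrite subrr scale0r addr0.
Qed.

Lemma slices_int_ext l F G y :
  (forall z, (forall j, j \notin l -> z 0 j = y 0 j) -> F z = G z) ->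
  slices_int l F y = slices_int l G y.
Proof.
elim: l y => [|j l IH] y H /=; first by apply: H.
rewrite /slice_int; congr int11; apply/funext => x; apply: IH => z zy.
apply: H => i; rewrite inE negb_or => /andP[ij il]; rewrite zy // !mxE eqxx /=.
by rewrite (negbTE ij) mulr0 addr0.
Qed.

Lemma slices_int_agree l F y z :
  (forall j, j \notin l -> z 0 j = y 0 j) -> slices_int l F y = slices_int l F z.
Proof.
elim: l y z => [|j l IH] y z H /=.
  by congr F; apply/rowP => j; rewrite H.
rewrite /slice_int; congr int11; apply/funext => x; apply: IH => i il.
rewrite !mxE eqxx /=; have [<-|ij] := eqVneq j i; first by rewrite !mulr1 !subrKC.
by rewrite !mulr0 !addr0 H // inE negb_or eq_sym ij.
Qed.

Lemma slices_int_shift l F y v : (forall j, j \in l -> v 0 j = 0) ->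
  slices_int l F (y + v) = slices_int l (fun z => F (z + v)) y.
Proof.
elim: l y => [//|j l IH] y H /=.
rewrite /slice_int; congr int11; apply/funext => x.
rewrite -IH => [|i il]; last by rewrite H ?inE ?il ?orbT.
by rewrite mxE (H j) ?inE ?eqxx // addr0 addrAC.
Qed.

Lemma slices_int_derive l (F dF : R -> 'rV[R]_n.+1 -> R) y :
  continuous (fun p : R * 'rV[R]_n.+1 => dF p.1 p.2) -> (forall t, continuous (F t)) ->
  (forall (t : R) y, is_derive t 1 (F^~ y) (dF t y)) ->
  forall t : R, is_derive t 1 (fun t => slices_int l (F t) y) (slices_int l (dF t) y).
Proof.
move=> cdF cF dFE; elim: l y => [|j l IH] y t /=; first exact: dFE.
apply: (int11_derive (fun t x => slices_int l (F t) (y + (x - y 0 j) *: e_ j))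
                     (fun t x => slices_int l (dF t) (y + (x - y 0 j) *: e_ j))).
- pose g (q : R * R) := (q.1, y + (q.2 - y 0 j) *: e_ j).
  apply: (continuous_compose _ _ _ g _ _ (slices_int_continuous2 _ l _ cdF)).
  apply: continuous_pair; first exact: continuous_fst.
  apply: continuous_addZ; first exact: continuous_const.
  by apply: continuous_add; [exact: continuous_snd|exact: continuous_const].
- by move=> s; exact/slice_continuous/slices_int_continuous.
Qed.

Lemma slices_int0 l y : slices_int l (fun _ => 0) y = 0.
Proof.
have -> : (fun _ => 0) = (fun z : 'rV[R]_n.+1 => 0 * (fun _ => 0 : R) z) :> ('rV[R]_n.+1 -> R).
  by apply/funext => z; rewrite mul0r.
by rewrite slices_intZ ?mul0r //; exact: continuous_const.
Qed.

(** Slices outside the one in direction [i] integrate zero. At that slice the inner integrals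
    commute with the derivative by Leibniz' rule, as [uniq l] keeps [i] out of them, and the
    fundamental theorem leaves two faces where [F] vanishes. The order of integration is never
    exchanged. *)
Lemma slices_int_partial l F i y : class_C 1 F -> i \in l -> uniq l ->
  (forall z, `|z 0 i| = 1 -> F z = 0) -> slices_int l (partial i F) y = 0.
Proof.
move=> C1F il ul F0; have cdF : continuous (partial i F) := class_C_partial 0 F i C1F.
have cF := class_C_continuous _ _ _ C1F.
elim: l y il ul => [//|j l IH] y; rewrite inE => + /andP[jl ul].
have [il _|il] := boolP (i \in l).
  rewrite /= /slice_int -[RHS](slices_int0 [:: j] y) /= /slice_int.
  by congr int11; apply/funext => x; exact: IH.
rewrite orbF => /eqP ij; move: jl; rewrite -{j}ij => _ /=.
(* [z] is [y] with coordinate [i] set to 0, so that the variable of integration is the coordinate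
   itself. *)
pose z := y - y 0 i *: e_ i.
have lineE (x : R) : y + (x - y 0 i) *: e_ i = z + x *: e_ i.
  by rewrite /z scalerBl addrA addrAC.
have shiftE (x : R) (G : 'rV[R]_n.+1 -> R) : slices_int l G (z + x *: e_ i) =
    slices_int l (fun w => G (w + x *: e_ i)) z.
  apply: slices_int_shift => k kl; rewrite !mxE eqxx /=.
  by rewrite (_ : (k == i) = false) ?mulr0 //; apply: contraNF il => /eqP <-.
have end0 (x : R) : `|x| = 1 -> slices_int l F (z + x *: e_ i) = 0.
  move=> x1; rewrite -[RHS](slices_int0 l (z + x *: e_ i)).
  apply: slices_int_ext => w wz; apply: F0; rewrite wz //.
  by rewrite !mxE !eqxx /= !mulr1 subrr add0r.
transitivity (slices_int l F (z + 1 *: e_ i) - slices_int l F (z + -1 *: e_ i)).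
  2: by rewrite !end0 ?subrr ?normrN ?normr1.
apply: (int11_primitive _ (fun x => slices_int l F (z + x *: e_ i))).
- exact/slice_continuous/slices_int_continuous.
- move=> x _; rewrite lineE shiftE.
  rewrite (_ : (fun x => _) = (fun x => slices_int l (fun w => F (w + x *: e_ i)) z)); last first.
    by apply/funext => s; rewrite shiftE.
  apply: (slices_int_derive l (fun x w => F (w + x *: e_ i))
    (fun x w => partial i F (w + x *: e_ i))).
  + apply: (continuous_compose _ _ _ (fun p : R * 'rV[R]_n.+1 => p.2 + p.1 *: e_ i) _ _ cdF).
    by apply: continuous_addZ; [exact: continuous_snd|exact: continuous_fst].
  + move=> s; have cw : continuous (fun w : 'rV[R]_n.+1 => w + s *: e_ i).
      by apply: continuous_addZ; [exact: continuous_ident|exact: continuous_const].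
    exact: (continuous_compose _ _ _ _ _ cw cF).
  + by move=> s w; apply: is_derive_line; exact: class_C1_is_derive.
Qed.

Lemma box_intD F G : continuous F -> continuous G ->
  box_int (fun y => F y + G y) = box_int F + box_int G.
Proof. exact: slices_intD. Qed.

Lemma box_intZ (a : R) F : continuous F -> box_int (fun y => a * F y) = a * box_int F.
Proof. exact: slices_intZ. Qed.

Lemma box_int_ge0 F : continuous F -> (forall y, 0 <= F y) -> 0 <= box_int F.
Proof. exact: slices_int_ge0. Qed.

Lemma box_int_gt0 F y : continuous F -> (forall y, 0 <= F y) ->
  (forall j, -1 < y 0 j < 1) -> 0 < F y -> 0 < box_int F.
Proof.
move=> cF F0 yI Fy; rewrite /box_int (slices_int_agree _ _ 0 y) => [|j].
  exact: slices_int_gt0.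
by rewrite mem_enum.
Qed.

Lemma box_int_partial F i : class_C 1 F ->
  (forall z, `|z 0 i| = 1 -> F z = 0) -> box_int (partial i F) = 0.
Proof. by move=> C1F; apply: slices_int_partial; rewrite ?mem_enum ?enum_uniq. Qed.

Lemma box_int_continuous (T : topologicalType) (F : T -> 'rV[R]_n.+1 -> R) :
  continuous (fun p : T * 'rV[R]_n.+1 => F p.1 p.2) -> continuous (fun t => box_int (F t)).
Proof.
move=> cF.
have c0 : continuous (fun t : T => (t, 0 : 'rV[R]_n.+1)).
  by apply: continuous_pair; [exact: continuous_ident|exact: continuous_const].
exact: (continuous_compose _ _ _ _ _ c0 (slices_int_continuous2 _ (enum 'I_n.+1) _ cF)).
Qed.

Lemma box_int_derive (F dF : R -> 'rV[R]_n.+1 -> R) :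
  continuous (fun p : R * 'rV[R]_n.+1 => dF p.1 p.2) -> (forall t, continuous (F t)) ->
  (forall (t : R) y, is_derive t 1 (F^~ y) (dF t y)) ->
  forall t : R, is_derive t 1 (fun t => box_int (F t)) (box_int (dF t)).
Proof. exact: slices_int_derive. Qed.

End BoxIntegral.

(** * Calculus of C^1 functions: products, coordinates, the squared Euclidean norm *)

Section ClassC1.
Context {R : realType} {n : nat}.
Implicit Types (f g : 'rV[R]_n.+1 -> R) (p v : 'rV[R]_n.+1).
Local Notation e_ j := (delta_mx 0 j : 'rV[R]_n.+1).

Lemma class_C1_with f (df : 'I_n.+1 -> 'rV[R]_n.+1 -> R) : continuous f ->
  (forall j p, is_derive p (e_ j) f (df j p)) -> (forall j, continuous (df j)) ->
  class_C 1 f /\ forall j, partial j f = df j.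
Proof.
move=> cf dfE cdf; split; first exact: class_C1_intro dfE cdf.
by move=> j; apply/funext => p; case: (dfE j p).
Qed.

Lemma class_C1_partial_continuous f j : class_C 1 f -> continuous (partial j f).
Proof. exact: class_C_partial. Qed.

Lemma class_C1_mul f g : class_C 1 f -> class_C 1 g ->
  class_C 1 (fun p => f p * g p) /\
  forall j, partial j (fun p => f p * g p) = fun p => f p * partial j g p + g p * partial j f p.
Proof.
move=> C1f C1g; have cf := class_C_continuous _ _ _ C1f; have cg := class_C_continuous _ _ _ C1g.
apply: class_C1_with; first exact: continuous_mul.
- by move=> j p; apply: is_deriveM; exact: class_C1_is_derive.
- by move=> j; apply: continuous_add; apply: continuous_mul => //;
    exact: class_C1_partial_continuous.
Qed.

Lemma is_derive_coord p v i : is_derive p v (fun p => p 0 i) (v 0 i).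
Proof.
apply: is_derive_line0.
have -> : (fun t : R => (p + t *: v) 0 i) = (fun t : R => p 0 i + v 0 i * t).
  by apply/funext => t; rewrite !mxE mulrC.
apply: (is_derive_eq (is_deriveD (is_derive_cst (p 0 i) _ _) (is_deriveZ (v 0 i) (is_derive_id _ _)))).
by rewrite add0r [_ *: _]mulr1.
Qed.

Lemma class_C1_coord i : class_C 1 (fun p => p 0 i) /\
  forall j, partial j (fun p => p 0 i) = fun _ => (i == j)%:R.
Proof.
apply: class_C1_with => [|j p|j]; first exact: row_coord_continuous.
- by have := is_derive_coord p (e_ j) i; rewrite mxE eqxx /=.
- exact: continuous_const.
Qed.

Lemma is_derive_real_comp (V : normedModType R) (h : R -> R) (g : V -> R) (p v : V) (d d' : R) :
  is_derive (g p) 1 h d -> is_derive p v g d' -> is_derive p v (fun q : V => h (g q)) (d * d').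
Proof.
move=> hd gd; apply: is_derive_line0.
apply: (@is_derive1_comp _ h (fun t : R => g (p + t *: v))); first by rewrite scale0r addr0.
by apply: is_derive_line; rewrite scale0r addr0.
Qed.

Definition sqnorm p : R := \sum_i p 0 i ^+ 2.

Lemma sqnorm_continuous : continuous sqnorm.
Proof. by apply: continuous_sum => i; apply: continuous_pow; exact: row_coord_continuous. Qed.

Lemma sqnorm_ge0 p : 0 <= sqnorm p.
Proof. by apply: sumr_ge0 => i _; exact: sqr_ge0. Qed.

Lemma is_derive_sqnorm p j : is_derive p (e_ j) sqnorm (2 * p 0 j).
Proof.
have -> : sqnorm = \sum_i ((fun p => p 0 i : R) ^+ 2).
  by apply/funext => q; rewrite fct_sumE.
apply: is_derive_eq; first by apply: is_derive_sum => i; apply: is_deriveX; exact: is_derive_coord.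
rewrite (bigD1 j) //= big1 => [|i ij]; first by rewrite mxE !eqxx addr0 /= [_ *: _]mulr1 expr1.
by rewrite mxE eqxx /= (negbTE ij) [_ *: _]mulr0.
Qed.

Lemma coord_sq_le p j : p 0 j ^+ 2 <= sqnorm p.
Proof. by rewrite /sqnorm (bigD1 j) //= lerDl sumr_ge0 // => i _; exact: sqr_ge0. Qed.

End ClassC1.

(** * C^1 radial cutoffs *)

Section Cutoff.
Context {R : realType}.
Implicit Types s t : R.

Definition pos s : R := Num.max 0 s.

Lemma pos_ge0 s : 0 <= pos s.
Proof. by rewrite /pos le_max lexx. Qed.

Lemma pos_eq0 s : s <= 0 -> pos s = 0.
Proof. by move=> s0; rewrite /pos max_l. Qed.

Lemma pos_id s : 0 <= s -> pos s = s.
Proof. by move=> s0; rewrite /pos max_r. Qed.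

Lemma pos_continuous : continuous pos.
Proof. by move=> s; apply: continuous_max; [exact: cvg_cst|exact: cvg_id]. Qed.

(** The quadratic error bound holds for all signs of [a] and [b], so the kink of [pos] at 0 needs no
    separate limit. This is what makes squares of [pos] usable as C^1 cutoffs. *)
Lemma is_derive_pos2 s : is_derive s 1 (fun s => pos s ^+ 2) (2 * pos s).
Proof.
suff lim : (fun h : R => h^-1 *: (pos (h *: (1:R) + s) ^+ 2 - pos s ^+ 2)) @ 0^' --> 2 * pos s.
  by split; [apply/cvg_ex; eexists; exact: lim|apply: cvg_lim => //; exact: lim].
have bound (a b : R) : `|pos b ^+ 2 - pos a ^+ 2 - 2 * pos a * (b - a)| <= (b - a) ^+ 2.
  have sq := sqr_ge0 (b - a); have sqa := sqr_ge0 a; have sqb := sqr_ge0 b.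
  rewrite !expr2 in sq sqa sqb *; rewrite ler_norml.
  case: (leP 0 a) => a0; case: (leP 0 b) => b0; apply/andP.
  - by rewrite (pos_id a) // (pos_id b) //; split; lra.
  - have ab : 0 <= a * - b by rewrite mulr_ge0 // oppr_ge0 ltW.
    by rewrite (pos_id a) // (pos_eq0 b (ltW b0)); split; lra.
  - have ab : 0 <= - a * b by rewrite mulr_ge0 // oppr_ge0 ltW.
    by rewrite (pos_id b) // (pos_eq0 a (ltW a0)); split; lra.
  - by rewrite (pos_eq0 b (ltW b0)) (pos_eq0 a (ltW a0)); split; lra.
apply/cvgrPdist_le => e e0; near=> h.
have h0 : h != 0 by near: h; exact: nbhs_dnbhs_neq.
have he : `|h| <= e by near: h; apply: dnbhs0_le.
apply: le_trans he; have hp : 0 < `|h| by rewrite normr_gt0.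
rewrite -(ler_pM2l hp) -normrM -expr2 real_normK ?num_real //.
have := bound s (h + s); rewrite addrK distrC => H.
apply: le_trans H; rewrite le_eqVlt; apply/orP; left; apply/eqP; congr `|_|.
by rewrite [h *: 1]mulr1 /GRing.scale /= mulrBr mulVKf //; ring.
Unshelve. all: by end_near. Qed.

(* [stretch s] is [s] for [s >= 1/4] and is positive everywhere, so that
   [radial_factor |y|^2 *: y] is a C^1 map on the whole space which equals
   [y / |y|] on the support of [bump |y|^2], the shell [1/2 < |y| < 1]. *)
Definition stretch s : R := s + 2 * pos (4^-1 - s) ^+ 2.

(** With [d = 1/4 - s > 0] the value is [2 d^2 - d + 1/4], whose discriminant is negative; this is
    the purpose of the coefficient 2. *)
Lemma stretch_gt0 s : 0 < stretch s.
Proof.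
rewrite /stretch; case: (leP 4^-1 s) => s4.
  by rewrite pos_eq0; lra.
by rewrite pos_id; nra.
Qed.

Lemma is_derive_stretch s : is_derive s 1 stretch (1 - 4 * pos (4^-1 - s)).
Proof.
have d1 : is_derive s 1 (fun s : R => 4^-1 - s) (-1).
  apply: (is_derive_eq (is_deriveB (is_derive_cst (4^-1 : R) _ _) (is_derive_id _ _))).
  by rewrite sub0r.
have d2 := is_derive_real_comp _ (fun s => pos s ^+ 2) (fun s : R => 4^-1 - s) _ _ _ _ (is_derive_pos2 (4^-1 - s)) d1.
apply: (is_derive_eq (is_deriveD (is_derive_id _ _) (is_deriveZ 2 d2))).
by rewrite /GRing.scale /=; ring.
Qed.

Definition radial_factor s : R := (Num.sqrt (stretch s))^-1.

Definition radial_factor' s : R :=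
  - (Num.sqrt (stretch s)) ^- 2 * ((2 * Num.sqrt (stretch s))^-1 * (1 - 4 * pos (4^-1 - s))).

Lemma sqrt_stretch_neq0 s : Num.sqrt (stretch s) != 0.
Proof. by rewrite gt_eqF // sqrtr_gt0 stretch_gt0. Qed.

Lemma is_derive_radial_factor s : is_derive s 1 radial_factor (radial_factor' s).
Proof.
apply: is_deriveV; first exact: sqrt_stretch_neq0.
apply: is_derive_real_comp; last exact: is_derive_stretch.
exact: is_derive1_sqrt (stretch_gt0 s).
Qed.

Lemma continuous_inv (f : R -> R) : continuous f -> (forall s, f s != 0) ->
  continuous (fun s => (f s)^-1).
Proof. by move=> cf f0 s; apply: cvgV; [exact: f0|exact: cf]. Qed.

Lemma stretch_pos_continuous : continuous (fun s : R => pos (4^-1 - s)).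
Proof.
apply: continuous_compose pos_continuous; apply: continuous_add; first exact: continuous_const.
by apply: continuous_opp; exact: continuous_ident.
Qed.

Lemma stretch_continuous : continuous stretch.
Proof.
apply: continuous_add; first exact: continuous_ident.
apply: continuous_mul; first exact: continuous_const.
exact/continuous_pow/stretch_pos_continuous.
Qed.

Lemma sqrt_stretch_continuous : continuous (fun s => Num.sqrt (stretch s)).
Proof. exact: continuous_compose stretch_continuous (@sqrt_continuous R). Qed.

Lemma radial_factor_continuous : continuous radial_factor.
Proof. exact: continuous_inv sqrt_stretch_continuous sqrt_stretch_neq0. Qed.

Lemma radial_factor'_continuous : continuous radial_factor'.
Proof.
apply: continuous_mul; [apply: continuous_opp; apply: continuous_inv|apply: continuous_mul].
- exact: continuous_pow sqrt_stretch_continuous.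
- by move=> s; rewrite expf_neq0 // sqrt_stretch_neq0.
- apply: continuous_inv => [|s]; last by rewrite mulf_neq0 ?sqrt_stretch_neq0.
  apply: continuous_mul; [exact: continuous_const|exact: sqrt_stretch_continuous].
- apply: continuous_add; first exact: continuous_const.
  apply: continuous_opp; apply: continuous_mul; first exact: continuous_const.
  exact: stretch_pos_continuous.
Qed.

(** As a function of [s = |y|^2] it vanishes for [s >= 1], which covers the faces of the cube and
    removes boundary terms, and for [s <= 1/4], where [to_sphere] need not land on the sphere. The
    square makes it C^1. *)
Definition bump s : R := pos ((s - 4^-1) * (1 - s)) ^+ 2.

Definition bump' s : R := 2 * pos ((s - 4^-1) * (1 - s)) * (5 / 4 - 2 * s).

Lemma is_derive_bump s : is_derive s 1 bump (bump' s).
Proof.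
apply: (is_derive_real_comp _ (fun s => pos s ^+ 2)); first exact: is_derive_pos2.
have d1 : is_derive s 1 (fun s : R => s - 4^-1) 1.
  apply: (is_derive_eq (is_deriveB (is_derive_id _ _) (is_derive_cst (4^-1 : R) _ _))).
  by rewrite subr0.
have d2 : is_derive s 1 (fun s : R => 1 - s) (-1).
  apply: (is_derive_eq (is_deriveB (is_derive_cst (1 : R) _ _) (is_derive_id _ _))).
  by rewrite sub0r.
apply: (is_derive_eq (is_deriveM d1 d2)).
by rewrite /GRing.scale /=; field.
Qed.

Lemma bump_arg_continuous : continuous (fun s : R => pos ((s - 4^-1) * (1 - s))).
Proof.
apply: continuous_compose pos_continuous; apply: continuous_mul; apply: continuous_add.
- exact: continuous_ident.
- exact: continuous_const.
- exact: continuous_const.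
- by apply: continuous_opp; exact: continuous_ident.
Qed.

Lemma bump_continuous : continuous bump.
Proof. exact: continuous_pow bump_arg_continuous. Qed.

Lemma bump'_continuous : continuous bump'.
Proof.
apply: continuous_mul.
  by apply: continuous_mul; [exact: continuous_const|exact: bump_arg_continuous].
apply: continuous_add; first exact: continuous_const.
by apply: continuous_opp; apply: continuous_mul; [exact: continuous_const|exact: continuous_ident].
Qed.

Lemma bump_ge0 s : 0 <= bump s.
Proof. exact: sqr_ge0. Qed.

Lemma bump_eq0 s : 1 <= s -> bump s = 0.
Proof. by move=> s1; rewrite /bump pos_eq0 ?expr0n //; nra. Qed.

Lemma bump_neq0 s : bump s != 0 -> 4^-1 < s.
Proof.
rewrite ltNge; apply: contraNN => s4.
by rewrite /bump pos_eq0 ?expr0n //; nra.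
Qed.

Lemma radial_factorE s : 4^-1 <= s -> radial_factor s = (Num.sqrt s)^-1.
Proof.
by move=> s4; rewrite /radial_factor /stretch pos_eq0 ?expr0n ?mulr0 ?addr0 // subr_le0.
Qed.

End Cutoff.

(** * Integrals over the unit sphere *)

Lemma continuous_scale {R : realType} (T : topologicalType) m (s : T -> R)
    (f : T -> 'rV[R]_m) :
  continuous s -> continuous f -> continuous (fun t => s t *: f t).
Proof. by move=> cs cf t; apply: cvgZ; [exact: cs|exact: cf]. Qed.

Section SphereIntegral.
Context {R : realType} {n : nat}.
Implicit Types (F G : 'rV[R]_n.+1 -> R) (x y : 'rV[R]_n.+1).
Local Notation e_ j := (delta_mx 0 j : 'rV[R]_n.+1).

Definition to_sphere y : 'rV[R]_n.+1 := radial_factor (sqnorm y) *: y.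

Definition sphere_lift G y : R := bump (sqnorm y) * G (to_sphere y).

(* Up to a constant, the integral of [G] over the unit sphere, written as a cube
   integral of [G (y / |y|)] against a radial weight supported in a shell. *)
Definition sphere_int G : R := box_int (sphere_lift G).

Lemma to_sphere_continuous : continuous to_sphere.
Proof.
apply: continuous_scale; last exact: continuous_ident.
exact: (continuous_compose _ _ _ _ _ sqnorm_continuous radial_factor_continuous).
Qed.

Lemma weight_continuous : continuous (fun y : 'rV[R]_n.+1 => bump (sqnorm y)).
Proof. exact: (continuous_compose _ _ _ _ _ sqnorm_continuous bump_continuous). Qed.

Lemma sphere_lift_continuous2 (T : topologicalType) (F : T -> 'rV[R]_n.+1 -> R) :
  continuous (fun p : T * 'rV[R]_n.+1 => F p.1 p.2) ->
  continuous (fun p : T * 'rV[R]_n.+1 => sphere_lift (F p.1) p.2).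
Proof.
move=> cF; apply: continuous_mul.
  exact: (continuous_compose _ _ _ _ _ (continuous_snd _ _) weight_continuous).
have cs : continuous (fun p : T * 'rV[R]_n.+1 => (p.1, to_sphere p.2)).
  apply: continuous_pair; first exact: continuous_fst.
  exact: (continuous_compose _ _ _ _ _ (continuous_snd _ _) to_sphere_continuous).
exact: (continuous_compose _ _ _ _ _ cs cF).
Qed.

Lemma sphere_lift_continuous G : continuous G -> continuous (sphere_lift G).
Proof.
move=> cG; apply: continuous_mul; first exact: weight_continuous.
exact: (continuous_compose _ _ _ _ _ to_sphere_continuous cG).
Qed.

Lemma sqnormZ (c : R) x : sqnorm (c *: x) = c ^+ 2 * sqnorm x.
Proof. by rewrite /sqnorm big_distrr /=; apply: eq_bigr => i _; rewrite mxE exprMn. Qed.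

Lemma sqnorm_to_sphere y : bump (sqnorm y) != 0 -> sqnorm (to_sphere y) = 1.
Proof.
move=> /bump_neq0 y4; have y0 : 0 < sqnorm y by apply: lt_trans y4; rewrite invr_gt0.
rewrite sqnormZ radial_factorE ?ltW // exprVn sqr_sqrtr ?ltW // mulVf //.
by rewrite gt_eqF.
Qed.

Lemma sphere_lift_ext F G y : (forall x, sqnorm x = 1 -> F x = G x) ->
  sphere_lift F y = sphere_lift G y.
Proof.
move=> FG; rewrite /sphere_lift; have [->|/sqnorm_to_sphere /FG -> //] := eqVneq (bump (sqnorm y)) 0.
by rewrite !mul0r.
Qed.

(** Where the weight is nonzero, [to_sphere] lands on the sphere. The relation [|x| = 1] may
    therefore be used under the integral although integrands are defined on the whole space. *)
Lemma sphere_int_ext F G : (forall x, sqnorm x = 1 -> F x = G x) ->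
  sphere_int F = sphere_int G.
Proof.
by move=> FG; congr box_int; apply/funext => y; exact: sphere_lift_ext.
Qed.

Lemma sphere_intD F G : continuous F -> continuous G ->
  sphere_int (fun x => F x + G x) = sphere_int F + sphere_int G.
Proof.
move=> cF cG; rewrite /sphere_int -box_intD; try exact: sphere_lift_continuous.
by congr box_int; apply/funext => y; rewrite /sphere_lift mulrDr.
Qed.

Lemma sphere_intZ (a : R) F : continuous F ->
  sphere_int (fun x => a * F x) = a * sphere_int F.
Proof.
move=> cF; rewrite /sphere_int -box_intZ; last exact: sphere_lift_continuous.
by congr box_int; apply/funext => y; rewrite /sphere_lift mulrCA.
Qed.

Lemma sphere_intB F G : continuous F -> continuous G ->
  sphere_int (fun x => F x - G x) = sphere_int F - sphere_int G.
Proof.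
move=> cF cG; rewrite -mulN1r -sphere_intZ // -sphere_intD //.
  by congr sphere_int; apply/funext => x; rewrite mulN1r.
by apply: continuous_mul => //; exact: continuous_const.
Qed.

Lemma sphere_int0 : sphere_int (fun _ => 0) = 0.
Proof.
rewrite -[RHS](mul0r (sphere_int (fun _ => 0))) -sphere_intZ; last exact: continuous_const.
by congr sphere_int; apply/funext => x; rewrite mul0r.
Qed.

Lemma sphere_int_sum (I : Type) (r : seq I) (F : I -> 'rV[R]_n.+1 -> R) :
  (forall i, continuous (F i)) ->
  sphere_int (fun x => \sum_(i <- r) F i x) = \sum_(i <- r) sphere_int (F i).
Proof.
move=> cF; elim: r => [|i r IH].
  by rewrite big_nil -[RHS]sphere_int0; congr sphere_int; apply/funext => x; rewrite big_nil.
rewrite big_cons -IH -sphere_intD //; last exact: continuous_sum.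
by congr sphere_int; apply/funext => x; rewrite big_cons.
Qed.

Lemma sphere_lift_ge0 G y : (forall x, sqnorm x = 1 -> 0 <= G x) -> 0 <= sphere_lift G y.
Proof.
move=> G0; rewrite /sphere_lift.
have [->|/sqnorm_to_sphere /G0 Gy] := eqVneq (bump (sqnorm y)) 0; first by rewrite mul0r.
by rewrite mulr_ge0 // bump_ge0.
Qed.

Lemma sphere_int_ge0 G : continuous G -> (forall x, sqnorm x = 1 -> 0 <= G x) ->
  0 <= sphere_int G.
Proof.
move=> cG G0; apply: box_int_ge0; first exact: sphere_lift_continuous.
by move=> y; exact: sphere_lift_ge0.
Qed.

Lemma sphere_int_le F G : continuous F -> continuous G ->
  (forall x, sqnorm x = 1 -> F x <= G x) -> sphere_int F <= sphere_int G.
Proof.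
move=> cF cG FG; rewrite -subr_ge0 -sphere_intB //; apply: sphere_int_ge0.
  by apply: continuous_add => //; exact: continuous_opp.
by move=> x /FG; rewrite subr_ge0.
Qed.

Lemma sphere_int_gt0 G x : continuous G -> (forall x, sqnorm x = 1 -> 0 <= G x) ->
  sqnorm x = 1 -> 0 < G x -> 0 < sphere_int G.
Proof.
(* The point [3/4 x] projects to [x], lies inside the open cube, and has squared norm 9/16, strictly
   between 1/4 and 1, where the weight is positive. *)
move=> cG G0 x1 Gx; pose y := (3 / 4 : R) *: x.
have ysq : sqnorm y = 9 / 16 by rewrite sqnormZ x1; field.
apply: (box_int_gt0 _ y); first exact: sphere_lift_continuous.
- by move=> z; exact: sphere_lift_ge0.
- move=> j; have := coord_sq_le y j; rewrite ysq => yj.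
  by rewrite -ltr_norml -(ltr_pXn2r (n := 2)) ?nnegrE // expr1n real_normK ?num_real //; lra.
have -> : sphere_lift G y = bump (9 / 16) * G x.
  rewrite /sphere_lift /to_sphere ysq radial_factorE; last lra.
  rewrite (_ : 9 / 16 = (3 / 4) ^+ 2 :> R); last by field.
  rewrite sqrtr_sqr ger0_norm; last lra.
  by rewrite /y scalerA mulVf ?scale1r //; lra.
by rewrite mulr_gt0 // /bump exprn_gt0 // pos_id; lra.
Qed.

Lemma sphere_int_continuous (T : topologicalType) (F : T -> 'rV[R]_n.+1 -> R) :
  continuous (fun p : T * 'rV[R]_n.+1 => F p.1 p.2) -> continuous (fun t => sphere_int (F t)).
Proof. by move=> cF; apply: box_int_continuous; exact: sphere_lift_continuous2. Qed.

Lemma sphere_int_derive (F dF : R -> 'rV[R]_n.+1 -> R) :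
  continuous (fun p : R * 'rV[R]_n.+1 => dF p.1 p.2) -> (forall t, continuous (F t)) ->
  (forall (t : R) y, is_derive t 1 (F^~ y) (dF t y)) ->
  forall t : R, is_derive t 1 (fun t => sphere_int (F t)) (sphere_int (dF t)).
Proof.
move=> cdF cF dFE.
apply: (box_int_derive (fun t => sphere_lift (F t)) (fun t => sphere_lift (dF t))).
- exact: sphere_lift_continuous2.
- by move=> t; exact: sphere_lift_continuous.

Qed.

Lemma is_derive_to_sphere y j l : is_derive y (e_ j) (fun y => to_sphere y 0 l)
  (radial_factor' (sqnorm y) * (2 * y 0 j) * y 0 l + radial_factor (sqnorm y) * (l == j)%:R).
Proof.
have -> : (fun y => to_sphere y 0 l) = (fun y => radial_factor (sqnorm y) * y 0 l).
  by apply/funext => z; rewrite mxE.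
have d1 := is_derive_real_comp _ radial_factor _ _ _ _ _
  (is_derive_radial_factor (sqnorm y)) (is_derive_sqnorm y j).
apply: (is_derive_eq (is_deriveM d1 (is_derive_coord y (e_ j) l))).
rewrite mxE eqxx /= addrC; congr (_ + _); rewrite [LHS]mulrC //.
Qed.

(** What matters is that [K] does not depend on [j]: the derivatives of the weight and of the radial
    factor only contribute a multiple of [y], which every rotation field annihilates. *)
Lemma sphere_lift_class_C1 G : class_C 1 G -> class_C 1 (sphere_lift G) /\
  exists K : 'rV[R]_n.+1 -> R, forall j, partial j (sphere_lift G) = fun y =>
    y 0 j * K y + bump (sqnorm y) * (radial_factor (sqnorm y) * partial j G (to_sphere y)).
Proof.
move=> C1G; have cG := class_C_continuous _ _ _ C1G.
have csq (h : R -> R) (ch : continuous h) := continuous_compose _ _ _ _ _ (@sqnorm_continuous R n) ch.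
have csp (F : 'rV[R]_n.+1 -> R) (cF : continuous F) := continuous_compose _ _ _ _ _ to_sphere_continuous cF.
have cdG j : continuous (partial j G) by exact: class_C1_partial_continuous.
pose A y := \sum_l y 0 l * partial l G (to_sphere y).
pose K y := 2 * (bump' (sqnorm y) * G (to_sphere y)
  + bump (sqnorm y) * (radial_factor' (sqnorm y) * A y)).
pose D j y := y 0 j * K y
  + bump (sqnorm y) * (radial_factor (sqnorm y) * partial j G (to_sphere y)).
have cA : continuous A.
  apply: continuous_sum => l; apply: continuous_mul; first exact: row_coord_continuous.
  exact: csp.
suff [? dE] : class_C 1 (sphere_lift G) /\ forall j, partial j (sphere_lift G) = D j.
  by split=> //; exists K.
apply: class_C1_with; first exact: sphere_lift_continuous.
- move=> j y.
  have d1 := is_derive_real_comp _ bump _ _ _ _ _ (is_derive_bump (sqnorm y)) (is_derive_sqnorm y j).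
  pose c' : 'rV[R]_n.+1 := \row_l (radial_factor' (sqnorm y) * (2 * y 0 j) * y 0 l
    + radial_factor (sqnorm y) * (l == j)%:R).
  have d2 : is_derive y (e_ j) (G \o to_sphere) (\sum_l c' 0 l * partial l G (to_sphere y)).
    by apply: is_derive_comp => // l; rewrite mxE; exact: is_derive_to_sphere.
  apply: (is_derive_eq (is_deriveM d1 d2)).
  have -> : \sum_l c' 0 l * partial l G (to_sphere y) =
      radial_factor' (sqnorm y) * (2 * y 0 j) * A y
      + radial_factor (sqnorm y) * partial j G (to_sphere y).
    under eq_bigr do rewrite mxE mulrDl.
    rewrite big_split /= /A big_distrr /=; congr (_ + _).
      by apply: eq_bigr => l _; rewrite -!mulrA.
    rewrite (bigD1 j) //= big1 ?eqxx ?mulr1 ?addr0 // => l lj.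
    by rewrite (negbTE lj) mulr0 mul0r.
  by rewrite /D /K /GRing.scale /=; ring.
- move=> j; apply: continuous_add; apply: continuous_mul.
  + exact: row_coord_continuous.
  + apply: continuous_mul; first exact: continuous_const.
    apply: continuous_add; apply: continuous_mul.
    * exact: csq _ bump'_continuous.
    * exact: csp.
    * exact: csq _ bump_continuous.
    * by apply: continuous_mul => //; exact: csq _ radial_factor'_continuous.
  + exact: csq _ bump_continuous.
  + by apply: continuous_mul; [exact: csq _ radial_factor_continuous|exact: csp].
Qed.

(* [to_sphere] commutes with rotations and the weight is invariant, so the
   rotation field may be applied to [sphere_lift G], where it is a divergence. *)
Lemma sphere_int_rotation G i j : class_C 1 G ->
  sphere_int (fun x => x 0 i * partial j G x - x 0 j * partial i G x) = 0.
Proof.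
move=> C1G; have [C1H [K dH]] := sphere_lift_class_C1 G C1G.
have H0 (z : 'rV[R]_n.+1) k : `|z 0 k| = 1 -> sphere_lift G z = 0.
  move=> zk; rewrite /sphere_lift bump_eq0 ?mul0r //.
  by rewrite -(expr1n _ 2) -zk real_normK ?num_real // coord_sq_le.
have coordH k l : class_C 1 (fun y => y 0 k * sphere_lift G y) /\
    partial l (fun y => y 0 k * sphere_lift G y) =
    fun y => y 0 k * partial l (sphere_lift G) y + sphere_lift G y * (k == l)%:R.
  have [C1k dk] := @class_C1_coord R n k.
  by have [C1 d] := class_C1_mul _ _ C1k C1H; split=> //; rewrite d dk.
have [Ci di] := coordH i j; have [Cj dj] := coordH j i.
have b0 k l : box_int (partial l (fun y => y 0 k * sphere_lift G y)) = 0.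
  apply: box_int_partial; first by have [] := coordH k l.
  by move=> z /H0 ->; rewrite mulr0.
(* With [H = sphere_lift G], [y_i d_j H - y_j d_i H = d_j (y_i H) - d_i (y_j H)], since the two
   Kronecker terms cancel. Each term on the right has integral 0 over the cube. *)
transitivity (box_int (fun y => partial j (fun y => y 0 i * sphere_lift G y) y
  + -1 * partial i (fun y => y 0 j * sphere_lift G y) y)); last first.
  have cp k l : continuous (partial l (fun y => y 0 k * sphere_lift G y)).
    by apply: class_C1_partial_continuous; have [] := coordH k l.
  rewrite box_intD ?box_intZ // ?b0 ?mulr0 ?addr0 //.
  by apply: continuous_mul => //; exact: continuous_const.
congr box_int; apply/funext => y; rewrite di dj !dH eq_sym /sphere_lift !mxE.
ring.
Qed.

(* Sum over [i] of the rotation identities for [x_i G]; [n] is the dimension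
   of the sphere in ['rV_n.+1]. *)
Lemma sphere_int_divergence G j : class_C 1 G ->
  sphere_int (fun x => partial j G x - x 0 j * \sum_i x 0 i * partial i G x)
    = n%:R * sphere_int (fun x => x 0 j * G x).
Proof.
move=> C1G; have cG := class_C_continuous _ _ _ C1G.
have cp i : continuous (partial i G) by exact: class_C1_partial_continuous.
have cc i : continuous (fun x : 'rV[R]_n.+1 => x 0 i) by exact: row_coord_continuous.
have C1x i := class_C1_mul _ _ (@class_C1_coord R n i).1 C1G.
have dx i l : partial l (fun x => x 0 i * G x) =
    fun x => x 0 i * partial l G x + G x * (i == l)%:R.
  by rewrite (C1x i).2 (@class_C1_coord R n i).2.
pose rot i x := x 0 i * partial j (fun x => x 0 i * G x) x
  - x 0 j * partial i (fun x => x 0 i * G x) x.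
have crot i : continuous (rot i).
  apply: continuous_add; last apply: continuous_opp.
    by apply: continuous_mul => //; apply: class_C1_partial_continuous; case: (C1x i).
  by apply: continuous_mul => //; apply: class_C1_partial_continuous; case: (C1x i).
have rot0 : sphere_int (fun x => \sum_i rot i x) = 0.
  rewrite sphere_int_sum // big1 // => i _.
  by apply: sphere_int_rotation; case: (C1x i).
have cdiv : continuous (fun x => partial j G x - x 0 j * \sum_i x 0 i * partial i G x).
  apply: continuous_add => //; apply/continuous_opp/continuous_mul => //.
  by apply: continuous_sum => i; exact: continuous_mul.
have cjG : continuous (fun x => x 0 j * G x) by exact: continuous_mul.
apply/eqP; rewrite -subr_eq0 -sphere_intZ // -sphere_intB //; last first.
  by apply: continuous_mul => //; exact: continuous_const.
apply/eqP; rewrite -[RHS]rot0; apply: sphere_int_ext => x x1.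
(* Once [|x| = 1] is used, the terms without derivatives are [x_j G] from [i = j] and
   [-(n + 1) x_j G] from differentiating [x_i]; together they give the factor [n]. *)
have -> : \sum_i rot i x = \sum_i (x 0 i ^+ 2 * partial j G x)
   + \sum_i (i == j)%:R * (x 0 i * G x)
   - (x 0 j * \sum_i x 0 i * partial i G x + \sum_(i < n.+1) x 0 j * G x).
  rewrite big_distrr -!big_split -sumrB /=; apply: eq_bigr => i _.
  by rewrite /rot !dx eqxx [_ * true%:R]mulr1; ring.
have pickE : \sum_i (i == j)%:R * (x 0 i * G x) = x 0 j * G x.
  rewrite (bigD1 j) //= big1 => [|i /negbTE ->]; last by rewrite mul0r.
  by rewrite eqxx addr0 [true%:R * _]mul1r.
rewrite -big_distrl /= -/(sqnorm x) x1 sumr_const card_ord -[_ *+ n.+1]mulr_natl.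
by rewrite pickE -natr1; ring.
Qed.

End SphereIntegral.

(** * Uniqueness for the Goursat problem *)

Section Goursat.
Context {R : realType}.

(** The mean value theorem applied to [c / lam * expR (lam * s)] plus or minus [f], whose
    derivatives are nonnegative on the interval. Integrating against the exponential weight gains
    [1 / lam]. *)
Lemma exp_comparison (f g : R -> R) (a x c lam : R) : 0 < lam -> a < x -> f a = 0 ->
  0 <= c ->
  (forall s : R, is_derive s 1 f (g s)) ->
  (forall s, a < s < x -> `|g s| <= c * expR (lam * s)) ->
  `|f x| <= c / lam * expR (lam * x).
Proof.
move=> lam0 ax fa c0 df gb.
have dE (s : R) : is_derive s 1 (fun s => c / lam * expR (lam * s)) (c * expR (lam * s)).
  have d1 : is_derive s 1 (fun s : R => lam * s) lam.
    by apply: (is_derive_eq (is_deriveZ lam (is_derive_id s 1))); rewrite [_ *: _]mulr1.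
  have d2 := is_derive_real_comp _ expR _ _ _ _ _ (is_derive_expR (lam * s)) d1.
  apply: (is_derive_eq (is_deriveZ (c / lam) d2)); rewrite /GRing.scale /=; field.
  by rewrite gt_eqF.
have Ea : 0 <= c / lam * expR (lam * a) by rewrite mulr_ge0 ?expR_ge0 // divr_ge0 // ltW.
have xa : 0 < x - a by rewrite subr_gt0.
rewrite ler_norml; apply/andP; split.
- have [s sI E] := mean_value (fun s => c / lam * expR (lam * s) + f s) _ _ _ ax
    (fun s _ => is_deriveD (dE s) (df s)).
  have := gb _ sI; rewrite ler_norml => /andP[g1 g2].
  have : 0 <= (c * expR (lam * s) + g s) * (x - a) by apply: mulr_ge0; [lra|exact: ltW].
  by rewrite -E fa; lra.
- have [s sI E] := mean_value (fun s => c / lam * expR (lam * s) - f s) _ _ _ ax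
    (fun s _ => is_deriveB (dE s) (df s)).
  have := gb _ sI; rewrite ler_norml => /andP[g1 g2].
  have : 0 <= (c * expR (lam * s) - g s) * (x - a) by apply: mulr_ge0; [lra|exact: ltW].
  by rewrite -E fa; lra.
Qed.

Lemma exp_comparison_half (f g : R -> R) (a x d lam K : R) : 0 < lam -> a < x -> f a = 0 ->
  0 <= d -> 0 <= K -> 2 * K <= lam ->
  (forall s : R, is_derive s 1 f (g s)) ->
  (forall s, a < s < x -> `|g s| <= K * (d * expR (lam * s))) ->
  `|f x| <= d / 2 * expR (lam * x).
Proof.
move=> lam0 ax fa d0 K0 Klam df gb.
apply: (@le_trans _ _ (K * d / lam * expR (lam * x))).
  apply: (exp_comparison f g a) => //; first exact: mulr_ge0.
  by move=> s /gb; rewrite mulrA.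
rewrite ler_wpM2r ?expR_ge0 // ler_pdivrMr // -subr_ge0.
have -> : d / 2 * lam - K * d = d / 2 * (lam - 2 * K) by field.
by apply: mulr_ge0; lra.
Qed.

Lemma eq0_of_le_halves (x C : R) : (forall N, `|x| <= C / 2 ^+ N) -> x = 0.
Proof.
move=> H; apply/eqP; rewrite -normr_le0 leNgt; apply/negP => x0.
have C0 : 0 <= C by have := H 0%N; rewrite expr0 divr1; apply: le_trans; exact: ltW.
have [N CN] : exists N, C / `|x| < N%:R.
  by exists (Num.bound (C / `|x|)); apply: archi_boundP; rewrite divr_ge0.
have := H N; rewrite leNgt => /negP; apply.
rewrite ltr_pdivrMr ?exprn_gt0 // mulrC -ltr_pdivrMr //.
apply: (lt_trans CN); rewrite -natrX ltr_nat; exact: ltn_expl.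
Qed.

(** Picard iteration in a norm weighted by [expR (lam * (u + v))]. [M] and [Mv] are recovered by
    integrating in [u] from [u = 1], and [Mu] by integrating in [v] from [v = 1]; each round halves
    the bound. The estimate on [W] is asked only for [u > 1] and [v > 1], because the moment
    equation is used with lower moments known to vanish only there. *)
Lemma goursat_uniqueness (M Mu Mv W : R -> R -> R) (U V K B : R) :
  0 <= K -> 0 <= B ->
  (forall u v : R, is_derive u 1 (M^~ v) (Mu u v)) ->
  (forall u v : R, is_derive v 1 (Mu u) (W u v)) ->
  (forall u v : R, is_derive u 1 (Mv^~ v) (W u v)) ->
  (forall v, 1 < v <= V -> M 1 v = 0) ->
  (forall u, 1 < u <= U -> Mu u 1 = 0) ->
  (forall v, 1 < v <= V -> Mv 1 v = 0) ->
  (forall u v, 1 < u <= U -> 1 < v <= V -> `|W u v| <= K * (`|M u v| + `|Mu u v| + `|Mv u v|)) ->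
  (forall u v, 1 < u <= U -> 1 < v <= V -> [/\ `|M u v| <= B, `|Mu u v| <= B & `|Mv u v| <= B]) ->
  forall u v, 1 < u <= U -> 1 < v <= V -> M u v = 0.
Proof.
move=> K0 B0 dM dMu dMv M1 Mu1 Mv1 WK MB.
(* Halving needs [lam >= 2 * (3 * K)] for [Mu] and [Mv], as [W] is bounded by [K] times a sum of
   three terms, and [lam >= 2] for [M], whose derivative is [Mu] with constant 1. *)
pose lam := 6 * K + 2; have lam0 : 0 < lam by rewrite /lam; lra.
suff key N : forall u v, 1 < u <= U -> 1 < v <= V ->
    let E := B / 2 ^+ N * (expR (lam * u) * expR (lam * v)) in
    [/\ `|M u v| <= E, `|Mu u v| <= E & `|Mv u v| <= E].
  move=> u v uI vI; apply: (eq0_of_le_halves _ (B * (expR (lam * u) * expR (lam * v)))) => N.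
  by have [+ _ _] := key N u v uI vI; rewrite mulrAC.
elim: N => [|N IH] u v uI vI E.
  have E1 : B <= E.
    rewrite /E expr0 divr1 ler_peMr // -expRD -[leLHS](@expR0 R) ler_expR.
    by apply: addr_ge0; apply: mulr_ge0; lra.
  by have [h1 h2 h3] := MB u v uI vI; split; apply: le_trans E1.
have BN : 0 <= B / 2 ^+ N by rewrite divr_ge0 // exprn_ge0.
have halfE : E = B / 2 ^+ N / 2 * (expR (lam * u) * expR (lam * v)).
  by rewrite /E exprS; field; rewrite expf_neq0.
have eu := expR_ge0 (lam * u); have ev := expR_ge0 (lam * v).
have W3 s t : 1 < s <= U -> 1 < t <= V ->
    `|W s t| <= 3 * K * (B / 2 ^+ N * (expR (lam * s) * expR (lam * t))).
  move=> sI tI; apply: le_trans (WK s t sI tI) _.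
  rewrite [leRHS]mulrAC [leRHS]mulrC ler_wpM2l //.
  have [] := IH s t sI tI; lra.
have lam3 : 2 * (3 * K) <= lam by rewrite /lam; lra.
have K3 : 0 <= 3 * K by rewrite mulr_ge0.
have [[u1 uU] [v1 vV]] := (andP uI, andP vI).
rewrite halfE; split.
- rewrite (mulrC (expR _)) mulrA (_ : _ / 2 * _ = B / 2 ^+ N * expR (lam * v) / 2); last by rewrite mulrAC.
  apply: (exp_comparison_half (M^~ v) (Mu^~ v) 1 u _ _ 1) => //.
  + exact: M1.
  + exact: mulr_ge0.
  + by rewrite /lam; lra.
  + move=> s /andP[s1 su]; rewrite mul1r -(mulrA (B / 2 ^+ N)) (mulrC (expR (lam * v))).
    by have [||_ + _] := IH s v; rewrite ?s1 ?(le_trans (ltW su)).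
- rewrite mulrA (_ : _ / 2 * _ = B / 2 ^+ N * expR (lam * u) / 2); last by rewrite mulrAC.
  apply: (exp_comparison_half (Mu u) (W u) 1 v _ _ (3 * K)) => //.
  + exact: Mu1.
  + exact: mulr_ge0.
  + by move=> s /andP[s1 sv]; rewrite -(mulrA (B / 2 ^+ N)); apply: W3; rewrite ?s1 ?(le_trans (ltW sv)).
- rewrite (mulrC (expR _)) mulrA (_ : _ / 2 * _ = B / 2 ^+ N * expR (lam * v) / 2); last by rewrite mulrAC.
  apply: (exp_comparison_half (Mv^~ v) (W^~ v) 1 u _ _ (3 * K)) => //.
  + exact: Mv1.
  + exact: mulr_ge0.
  + move=> s /andP[s1 su]; rewrite -(mulrA (B / 2 ^+ N)) (mulrC (expR (lam * v))).
    by apply: W3; rewrite ?s1 ?(le_trans (ltW su)).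
Qed.

Lemma bounded_on_rectangle (F : R -> R -> R) (a b c d : R) :
  continuous (fun p : R * R => F p.1 p.2) ->
  exists2 B, 0 <= B & forall u v, a <= u <= b -> c <= v <= d -> `|F u v| <= B.
Proof.
move=> cF.
have cK : compact (`[a, b]%classic `*` `[c, d]%classic : set (R * R)).
  by apply: compact_setX; exact: segment_compact.
have /compact_bounded [B [Breal HB]] : compact ((fun p : R * R => F p.1 p.2) @` (`[a, b] `*` `[c, d])).
  by apply: continuous_compact cK; exact: continuous_subspaceT.
exists (`|B| + 1) => [|u v uI vI]; first by rewrite addr_ge0.
apply: (HB (`|B| + 1)); first by rewrite ltr_pwDr // ler_norm.
by exists (u, v) => //; split; rewrite /= in_itv.
Qed.

End Goursat.

(** * Null coordinates and moments *)

Lemma row_continuous {R : realType} (T : topologicalType) k (f : T -> 'rV[R]_k.+1) :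
  (forall j, continuous (fun y => f y 0 j)) -> continuous f.
Proof.
move=> cf t; apply/cvgrPdist_le => e e0.
have : \forall q \near t, forall j, `|f t 0 j - f q 0 j| <= e.
  apply: (@filter_forall _ _ (fun j q => `|f t 0 j - f q 0 j| <= e) (nbhs t) (nbhs_filter t)) => j.
  by have /cvgrPdist_le := cf j t; apply.
apply: filterS => q H; apply: row_norm_le => [|j]; first exact: ltW.
by rewrite !mxE.
Qed.

Section Moments.
Context {R : realType} {m : nat}.
Implicit Types (psi : 'rV[R]_m.+2 -> R) (x : 'rV[R]_m.+1) (t u v r : R).

Definition spacetime_pt t x : 'rV[R]_m.+2 :=
  \row_j (if unlift ord0 j is Some i then x 0 i else t).

Lemma spacetime_pt0 t x : spacetime_pt t x 0 ord0 = t.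
Proof. by rewrite mxE unlift_none. Qed.

Lemma spacetime_ptS t x i : spacetime_pt t x 0 (lift ord0 i) = x 0 i.
Proof. by rewrite mxE liftK. Qed.

Lemma is_derive_spacetime_pt (V : normedModType R) psi (t : V -> R) (x : V -> 'rV[R]_m.+1)
    (t' : R) (x' : 'I_m.+1 -> R) (p v : V) : class_C 1 psi ->
  is_derive p v t t' -> (forall i, is_derive p v (fun q => x q 0 i) (x' i)) ->
  is_derive p v (fun q => psi (spacetime_pt (t q) (x q)))
    (t' * partial ord0 psi (spacetime_pt (t p) (x p))
     + \sum_i x' i * partial (lift ord0 i) psi (spacetime_pt (t p) (x p))).
Proof.
move=> C1 dt dx.
have dc j : is_derive p v (fun q => spacetime_pt (t q) (x q) 0 j)
    (spacetime_pt t' (\row_i x' i) 0 j).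
  have [i ->|->] := unliftP ord0 j.
    rewrite spacetime_ptS mxE (_ : (fun _ => _) = (fun q => x q 0 i)) //.
    by apply/funext => q; rewrite spacetime_ptS.
  rewrite spacetime_pt0 (_ : (fun _ => _) = t) //.
  by apply/funext => q; rewrite spacetime_pt0.
apply: (is_derive_eq (is_derive_comp V _ _ psi p v C1 dc)).
rewrite big_ord_recl spacetime_pt0; congr (_ + _); apply: eq_bigr => i _.
by rewrite spacetime_ptS mxE.
Qed.

(* The point with null coordinates [u], [v] in the direction [x], [|x| = 1]. *)
Definition null_pt u v x : 'rV[R]_m.+2 := spacetime_pt ((u - v) / 2) (((u + v) / 2) *: x).

(* The derivative of [psi] in [r = (u + v) / 2]. *)
Definition radial psi u v x : R :=
  \sum_i x 0 i * partial (lift ord0 i) psi (null_pt u v x).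

Lemma is_derive_lin (a b t : R) : is_derive t 1 (fun t : R => a + b * t) b.
Proof.
apply: (is_derive_eq (is_deriveD (is_derive_cst a _ _) (is_deriveZ b (is_derive_id t 1)))).
by rewrite add0r [_ *: _]mulr1.
Qed.

Lemma is_derive_u psi u v x : class_C 1 psi ->
  is_derive u 1 (fun u => psi (null_pt u v x))
    (2^-1 * (partial ord0 psi (null_pt u v x) + radial psi u v x)).
Proof.
move=> C1.
have d1 : is_derive u 1 (fun u : R => (u - v) / 2) 2^-1.
  rewrite (_ : (fun u => _) = (fun u => - v / 2 + 2^-1 * u)); first exact: is_derive_lin.
  by apply/funext => s; field.
have d2 i : is_derive u 1 (fun u : R => (((u + v) / 2) *: x) 0 i) (x 0 i / 2).
  rewrite (_ : (fun u => _) = (fun u => v * x 0 i / 2 + x 0 i / 2 * u)); first exact: is_derive_lin.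
  by apply/funext => s; rewrite mxE; field.
apply: (is_derive_eq (is_derive_spacetime_pt _ _ _ _ _ _ _ _ C1 d1 d2)).
rewrite mulrDr /radial big_distrr /=; congr (_ + _); apply: eq_bigr => i _.
by rewrite -/(null_pt u v x); field.
Qed.

Lemma is_derive_v psi u v x : class_C 1 psi ->
  is_derive v 1 (fun v => psi (null_pt u v x))
    (2^-1 * (radial psi u v x - partial ord0 psi (null_pt u v x))).
Proof.
move=> C1.
have d1 : is_derive v 1 (fun v : R => (u - v) / 2) (- 2^-1).
  rewrite (_ : (fun v => _) = (fun v => u / 2 + - 2^-1 * v)); first exact: is_derive_lin.
  by apply/funext => s; field.
have d2 i : is_derive v 1 (fun v : R => (((u + v) / 2) *: x) 0 i) (x 0 i / 2).
  rewrite (_ : (fun v => _) = (fun v => u * x 0 i / 2 + x 0 i / 2 * v)); first exact: is_derive_lin.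
  by apply/funext => s; rewrite mxE; field.
apply: (is_derive_eq (is_derive_spacetime_pt _ _ _ _ _ _ _ _ C1 d1 d2)).
rewrite mulrBr addrC mulNr /radial big_distrr /=; congr (_ + _); apply: eq_bigr => i _.
by rewrite -/(null_pt u v x); field.
Qed.

Lemma spacetime_pt_continuous (T : topologicalType) (t : T -> R) (x : T -> 'rV[R]_m.+1) :
  continuous t -> continuous x -> continuous (fun q => spacetime_pt (t q) (x q)).
Proof.
move=> ct cx; apply: row_continuous => j; have [i ->|->] := unliftP ord0 j.
  under eq_fun do rewrite spacetime_ptS.
  exact: (continuous_compose _ _ _ _ _ cx (row_coord_continuous i)).
by under eq_fun do rewrite spacetime_pt0.
Qed.

(** [x] is not restricted to the sphere here: this extension lets the sphere identities be applied
    with ordinary partial derivatives, at the cost of a factor [r] for each one. *)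
Lemma class_C1_slice psi t r : class_C 1 psi ->
  class_C 1 (fun x => psi (spacetime_pt t (r *: x))) /\
  forall i, partial i (fun x => psi (spacetime_pt t (r *: x))) =
    fun x => r * partial (lift ord0 i) psi (spacetime_pt t (r *: x)).
Proof.
move=> C1.
have cs : continuous (fun x : 'rV[R]_m.+1 => spacetime_pt t (r *: x)).
  apply: spacetime_pt_continuous; first exact: continuous_const.
  by apply: continuous_scale; [exact: continuous_const|exact: continuous_ident].
have comp (f : 'rV[R]_m.+2 -> R) (cf : continuous f) := continuous_compose _ _ _ _ _ cs cf.
apply: class_C1_with; first exact: comp (class_C_continuous _ _ _ C1).
- move=> j x.
  have dx i : is_derive x (delta_mx 0 j) (fun x : 'rV[R]_m.+1 => (r *: x) 0 i) (r * (i == j)%:R).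
    rewrite (_ : (fun _ => _) = (fun x : 'rV[R]_m.+1 => r * x 0 i)); last first.
      by apply/funext => y; rewrite mxE.
    apply: (is_derive_eq (is_deriveZ r (is_derive_coord x (delta_mx 0 j) i))).
    by rewrite mxE eqxx.
  apply: (is_derive_eq (is_derive_spacetime_pt _ psi (cst t) _ _ _ _ _ C1 (is_derive_cst _ _ _) dx)).
  rewrite mul0r add0r (bigD1 j) //= big1 => [|i /negbTE ->]; last by rewrite mulr0 mul0r.
  by rewrite eqxx addr0 [r * true%:R]mulr1.
- move=> j; apply: continuous_mul; first exact: continuous_const.
  exact: comp (class_C1_partial_continuous _ _ C1).
Qed.

Lemma null_pt_continuous :
  continuous (fun p : R * R * 'rV[R]_m.+1 => null_pt p.1.1 p.1.2 p.2).
Proof.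
have c1 : continuous (fun p : R * R * 'rV[R]_m.+1 => p.1) by exact: continuous_fst.
have c11 := continuous_compose _ _ _ _ _ c1 (@continuous_fst R R).
have c12 := continuous_compose _ _ _ _ _ c1 (@continuous_snd R R).
apply: spacetime_pt_continuous.
  apply: continuous_mul; last exact: continuous_const.
  by apply: continuous_add => //; exact: continuous_opp.
apply: continuous_scale; last exact: continuous_snd.
apply: continuous_mul; last exact: continuous_const.
exact: continuous_add.
Qed.

End Moments.

(** * Integration by parts on the sphere against powers of [a.x] *)

Section MomentEquations.
Context {R : realType} {m : nat}.
Implicit Types (psi phi : 'rV[R]_m.+2 -> R) (a x : 'rV[R]_m.+1) (t u v r : R) (k : nat).
Local Notation d0 := (partial (ord0 : 'I_m.+2)).
Local Notation ds i := (partial (lift (ord0 : 'I_m.+2) i)).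

Definition dotr a x : R := \sum_i a 0 i * x 0 i.

Lemma dotr_continuous a : continuous (dotr a).
Proof.
apply: continuous_sum => i; apply: continuous_mul; first exact: continuous_const.
exact: row_coord_continuous.
Qed.

Lemma dotr_pow_continuous a k : continuous (fun x => dotr a x ^+ k).
Proof. exact/continuous_pow/dotr_continuous. Qed.

Lemma is_derive_dotr a x (v : 'rV[R]_m.+1) : is_derive x v (dotr a) (dotr a v).
Proof.
apply: is_derive_line0.
rewrite (_ : (fun _ => _) = (fun t : R => dotr a x + dotr a v * t)); first exact: is_derive_lin.
apply/funext => t; rewrite /dotr mulrC big_distrr -big_split /=; apply: eq_bigr => i _.
by rewrite !mxE mulrDr mulrCA.
Qed.

Lemma class_C1_dotr_pow a k : class_C 1 (fun x => dotr a x ^+ k) /\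
  forall j, partial j (fun x => dotr a x ^+ k) =
    fun x => k%:R * dotr a x ^+ k.-1 * a 0 j.
Proof.
apply: class_C1_with => [|j x|j]; first exact: dotr_pow_continuous.
- rewrite -exprfctE.
  apply: (is_derive_eq (is_deriveX k (is_derive_dotr a x (delta_mx 0 j)))).
  congr (_ * _); rewrite /dotr (bigD1 j) //= big1 => [|i ij].
    by rewrite mxE !eqxx addr0 [_ * true%:R]mulr1.
  by rewrite mxE (negbTE ij) andbF mulr0.
- apply: continuous_mul; last exact: continuous_const.
  by apply: continuous_mul; [exact: continuous_const|exact: dotr_pow_continuous].
Qed.

(* The truncated exponent [k.-1] is harmless: it comes with the factor [k]. *)
Lemma moment_divergence a k (f : 'I_m.+1 -> 'rV[R]_m.+1 -> R) :
  (forall j, class_C 1 (f j)) ->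
  sphere_int (fun x =>
      (\sum_j (partial j (f j) x - x 0 j * \sum_i x 0 i * partial i (f j) x)) * dotr a x ^+ k)
  + k%:R * sphere_int (fun x =>
      (\sum_j a 0 j * f j x - dotr a x * \sum_j x 0 j * f j x) * dotr a x ^+ k.-1)
  = m%:R * sphere_int (fun x => (\sum_j x 0 j * f j x) * dotr a x ^+ k).
Proof.
move=> C1f; have cf j := class_C_continuous _ _ _ (C1f j).
have cp i j : continuous (partial i (f j)) by exact: class_C1_partial_continuous.
have cc i := @row_coord_continuous R m i.
have cs l := dotr_pow_continuous a l.
have C1g j := class_C1_mul _ _ (C1f j) (class_C1_dotr_pow a k).1.
(* Summing [sphere_int_divergence] for [g j] over [j] integrates the tangential divergence of the
   vector field [f] times [(a.x)^k]; the product rule splits it into the two terms on the left. *)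
pose g j x := f j x * dotr a x ^+ k.
have cdiv j : continuous (fun x => partial j (g j) x - x 0 j * \sum_i x 0 i * partial i (g j) x).
  have cpg i : continuous (partial i (g j)) by apply: class_C1_partial_continuous; case: (C1g j).
  apply: continuous_add => //; apply/continuous_opp/continuous_mul => //.
  by apply: continuous_sum => i; exact: continuous_mul.
have cxg j : continuous (fun x => x 0 j * g j x).
  by apply: continuous_mul => //; exact: continuous_mul.
have -> : sphere_int (fun x => (\sum_j x 0 j * f j x) * dotr a x ^+ k)
    = \sum_j sphere_int (fun x => x 0 j * g j x).
  rewrite -sphere_int_sum //; congr sphere_int; apply/funext => x.
  by rewrite big_distrl /=; apply: eq_bigr => j _; rewrite mulrA.
rewrite big_distrr /=.
under [RHS]eq_bigr => j _.
  rewrite -sphere_int_divergence; last by case: (C1g j).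
  over.
rewrite -sphere_int_sum // -sphere_intZ; last first.
  apply: continuous_mul => //; apply: continuous_add.
    by apply: continuous_sum => j; apply: continuous_mul => //; exact: continuous_const.
  apply/continuous_opp/continuous_mul; first exact: dotr_continuous.
  by apply: continuous_sum => j; exact: continuous_mul.
rewrite -sphere_intD; last 2 first.
- apply: continuous_mul => //; apply: continuous_sum => j.
  apply: continuous_add => //; apply/continuous_opp/continuous_mul => //.
  by apply: continuous_sum => i; exact: continuous_mul.
- apply: continuous_mul; first exact: continuous_const.
  apply: continuous_mul => //; apply: continuous_add.
    by apply: continuous_sum => j; apply: continuous_mul => //; exact: continuous_const.
  apply/continuous_opp/continuous_mul; first exact: dotr_continuous.
  by apply: continuous_sum => j; exact: continuous_mul.
congr sphere_int; apply/funext => x.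
pose s := dotr a x; pose q := k%:R * s ^+ k.-1.
have dg i j : partial i (g j) x = s ^+ k * partial i (f j) x + q * (f j x * a 0 i).
  rewrite (C1g j).2 (class_C1_dotr_pow a k).2 /= -/s /q; ring.
have euler j : \sum_i x 0 i * partial i (g j) x =
    s ^+ k * (\sum_i x 0 i * partial i (f j) x) + q * (f j x * s).
  rewrite /s {2}/dotr !big_distrr -big_split /=; apply: eq_bigr => i _.
  by rewrite dg /s; ring.
pose c := q * s.
transitivity (s ^+ k * (\sum_j (partial j (f j) x - x 0 j * \sum_i x 0 i * partial i (f j) x))
  + (q * (\sum_j a 0 j * f j x) - c * (\sum_j x 0 j * f j x))).
  by rewrite /c /q -/s; ring.
rewrite !big_distrr /= -sumrB -big_split /=; apply: eq_bigr => j _.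
by rewrite euler dg /c; ring.
Qed.

End MomentEquations.

(** * Null derivatives of [phi] and their moments *)

Section NullMoments.
Context {R : realType} {m : nat}.
Implicit Types (psi phi : 'rV[R]_m.+2 -> R) (a x : 'rV[R]_m.+1) (t u v r : R) (k : nat).
Local Notation d0 := (partial (ord0 : 'I_m.+2)).
Local Notation ds i := (partial (lift (ord0 : 'I_m.+2) i)).

Definition radial2 psi u v x : R := \sum_i x 0 i * radial (ds i psi) u v x.

(* Joint continuity in [u], [v] and [x]. *)
Definition jcontinuous (F : R -> R -> 'rV[R]_m.+1 -> R) :=
  continuous (fun p : R * R * 'rV[R]_m.+1 => F p.1.1 p.1.2 p.2).

Lemma null_jcontinuous psi : continuous psi -> jcontinuous (fun u v x => psi (null_pt u v x)).
Proof. by move=> c; exact: (continuous_compose _ _ _ _ _ null_pt_continuous c). Qed.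

Lemma snd_jcontinuous (F : 'rV[R]_m.+1 -> R) : continuous F -> jcontinuous (fun _ _ x => F x).
Proof. by move=> c; exact: (continuous_compose _ _ _ _ _ (continuous_snd _ _) c). Qed.

Lemma radial_jcontinuous psi : class_C 1 psi -> jcontinuous (radial psi).
Proof.
move=> C1; apply: continuous_sum => i; apply: continuous_mul.
  exact: (snd_jcontinuous (fun x => x 0 i) (row_coord_continuous i)).
by apply: null_jcontinuous; exact: class_C1_partial_continuous.
Qed.

Lemma radial2_jcontinuous psi : class_C 2 psi -> jcontinuous (radial2 psi).
Proof.
move=> C2; apply: continuous_sum => i; apply: continuous_mul.
  exact: (snd_jcontinuous (fun x => x 0 i) (row_coord_continuous i)).
by apply: radial_jcontinuous; exact: class_C_partial C2.
Qed.

Lemma jcontinuous_u F v : jcontinuous F ->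
  continuous (fun p : R * 'rV[R]_m.+1 => F p.1 v p.2).
Proof.
move=> cF.
have c : continuous (fun p : R * 'rV[R]_m.+1 => (p.1, v, p.2)).
  apply: continuous_pair; last exact: continuous_snd.
  by apply: continuous_pair; [exact: continuous_fst|exact: continuous_const].
exact: (continuous_compose _ _ _ _ _ c cF).
Qed.

Lemma jcontinuous_v F u : jcontinuous F ->
  continuous (fun p : R * 'rV[R]_m.+1 => F u p.1 p.2).
Proof.
move=> cF.
have c : continuous (fun p : R * 'rV[R]_m.+1 => (u, p.1, p.2)).
  apply: continuous_pair; last exact: continuous_snd.
  by apply: continuous_pair; [exact: continuous_const|exact: continuous_fst].
exact: (continuous_compose _ _ _ _ _ c cF).
Qed.

Lemma jcontinuous_slice F u v : jcontinuous F -> continuous (F u v).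
Proof.
move=> cF; apply: (continuous_curry_slice R (fun v => F u v) v).
exact: jcontinuous_v.
Qed.

Definition moment a k (F : R -> R -> 'rV[R]_m.+1 -> R) u v : R :=
  sphere_int (fun x => F u v x * dotr a x ^+ k).

Lemma moment_continuous a k F : jcontinuous F ->
  continuous (fun p : R * R => moment a k F p.1 p.2).
Proof.
move=> cF; apply: (sphere_int_continuous _ (fun (p : R * R) x => F p.1 p.2 x * dotr a x ^+ k)).
apply: continuous_mul => //.
exact: (snd_jcontinuous (fun x => dotr a x ^+ k) (dotr_pow_continuous a k)).
Qed.

Lemma moment_integrand_continuous a k F u v : jcontinuous F ->
  continuous (fun x => F u v x * dotr a x ^+ k).
Proof.
move=> cF; apply: continuous_mul; first exact: jcontinuous_slice.
exact: dotr_pow_continuous.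
Qed.

Lemma is_derive_mulr (f : R -> R) (c t d : R) :
  is_derive t 1 f d -> is_derive t 1 (fun t => f t * c) (d * c).
Proof.
move=> df; under eq_fun do rewrite mulrC.
by apply: (is_derive_eq (is_deriveZ c df)); rewrite mulrC.
Qed.

Lemma moment_derive_u a k F dF : jcontinuous F -> jcontinuous dF ->
  (forall u v x, is_derive u 1 (fun u => F u v x) (dF u v x)) ->
  forall u v, is_derive u 1 ((moment a k F)^~ v) (moment a k dF u v).
Proof.
move=> cF cdF dFE u v.
apply: (sphere_int_derive (fun u x => F u v x * dotr a x ^+ k)
                          (fun u x => dF u v x * dotr a x ^+ k)).
- apply: continuous_mul; first exact: jcontinuous_u.
  exact: (continuous_compose _ _ _ _ _ (continuous_snd _ _) (dotr_pow_continuous a k)).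
- by move=> s; exact: moment_integrand_continuous.
- by move=> s x; exact: is_derive_mulr.
Qed.

Lemma moment_derive_v a k F dF : jcontinuous F -> jcontinuous dF ->
  (forall u v x, is_derive v 1 (fun v => F u v x) (dF u v x)) ->
  forall u v, is_derive v 1 (moment a k F u) (moment a k dF u v).
Proof.
move=> cF cdF dFE u v.
apply: (sphere_int_derive (fun v x => F u v x * dotr a x ^+ k)
                          (fun v x => dF u v x * dotr a x ^+ k)).
- apply: continuous_mul; first exact: jcontinuous_v.
  exact: (continuous_compose _ _ _ _ _ (continuous_snd _ _) (dotr_pow_continuous a k)).
- by move=> s; exact: moment_integrand_continuous.
- by move=> s x; exact: is_derive_mulr.
Qed.

(* For [|x| = 1] these are [phi] and its derivatives in [u], in [v] and in both. *)
Definition value_part phi u v x : R := phi (null_pt u v x).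
Definition u_part phi u v x : R := 2^-1 * (d0 phi (null_pt u v x) + radial phi u v x).
Definition v_part phi u v x : R := 2^-1 * (radial phi u v x - d0 phi (null_pt u v x)).
Definition uv_part phi u v x : R := 4^-1 * (radial2 phi u v x - d0 (d0 phi) (null_pt u v x)).

Section Solution.
Context (phi : 'rV[R]_m.+2 -> R) (C2 : class_C 2 phi).

Let C1 : class_C 1 phi := class_C_pred _ _ _ C2.
Let C1p j : class_C 1 (partial j phi) := class_C_partial _ _ j C2.
Let cp j : continuous (partial j phi) := class_C_continuous _ _ _ (C1p j).
Let cpp i j : continuous (partial i (partial j phi)) := class_C1_partial_continuous _ i (C1p j).

Lemma value_part_jcontinuous : jcontinuous (value_part phi).
Proof. exact: null_jcontinuous (class_C_continuous _ _ _ C1). Qed.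

Lemma u_part_jcontinuous : jcontinuous (u_part phi).
Proof.
apply: continuous_mul; first exact: continuous_const.
by apply: continuous_add; [exact: null_jcontinuous|exact: radial_jcontinuous].
Qed.

Lemma v_part_jcontinuous : jcontinuous (v_part phi).
Proof.
apply: continuous_mul; first exact: continuous_const.
apply: continuous_add; first exact: radial_jcontinuous.
by apply: continuous_opp; exact: null_jcontinuous.
Qed.

Lemma uv_part_jcontinuous : jcontinuous (uv_part phi).
Proof.
apply: continuous_mul; first exact: continuous_const.
apply: continuous_add; first exact: radial2_jcontinuous.
by apply: continuous_opp; exact: null_jcontinuous.
Qed.

(** Symmetry of second derivatives enters here: the mixed [t], [r] terms cancel, and [d_v d_u] and
    [d_u d_v] both give [uv_part]. *)
Lemma sum_commute u v x :
  \sum_i x 0 i * d0 (ds i phi) (null_pt u v x) = radial (d0 phi) u v x.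
Proof. by apply: eq_bigr => i _; rewrite partial_commute. Qed.

Lemma is_derive_sumZ (f : 'I_m.+1 -> R -> R) (c d : 'I_m.+1 -> R) t :
  (forall i, is_derive t 1 (f i) (d i)) ->
  is_derive t 1 (fun t => \sum_i c i * f i t) (\sum_i c i * d i).
Proof.
move=> df; rewrite (_ : (fun _ => _) = \sum_i (c i *: f i)); last first.
  by apply/funext => s; rewrite fct_sumE.
exact: is_derive_sum.
Qed.

Lemma u_part_derive_v u v x :
  is_derive v 1 (fun v => u_part phi u v x) (uv_part phi u v x).
Proof.
have d1 := is_derive_v (d0 phi) u v x (C1p ord0).
have d2 := is_derive_sumZ (fun i v => ds i phi (null_pt u v x)) (fun i => x 0 i) _ v
  (fun i => is_derive_v (ds i phi) u v x (C1p _)).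
apply: (is_derive_eq (is_deriveZ 2^-1 (is_deriveD d1 d2))).
have -> : \sum_i x 0 i * (2^-1 * (radial (ds i phi) u v x - d0 (ds i phi) (null_pt u v x)))
    = 2^-1 * (radial2 phi u v x - radial (d0 phi) u v x).
  rewrite -sum_commute /radial2 -sumrB big_distrr /=; apply: eq_bigr => i _; ring.
by rewrite /uv_part /GRing.scale /=; field.
Qed.

Lemma v_part_derive_u u v x :
  is_derive u 1 (fun u => v_part phi u v x) (uv_part phi u v x).
Proof.
have d1 := is_derive_u (d0 phi) u v x (C1p ord0).
have d2 := is_derive_sumZ (fun i u => ds i phi (null_pt u v x)) (fun i => x 0 i) _ u
  (fun i => is_derive_u (ds i phi) u v x (C1p _)).
apply: (is_derive_eq (is_deriveZ 2^-1 (is_deriveB d2 d1))).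
have -> : \sum_i x 0 i * (2^-1 * (d0 (ds i phi) (null_pt u v x) + radial (ds i phi) u v x))
    = 2^-1 * (radial2 phi u v x + radial (d0 phi) u v x).
  rewrite -sum_commute /radial2 -big_split big_distrr /=; apply: eq_bigr => i _; ring.
by rewrite /uv_part /GRing.scale /=; field.
Qed.

End Solution.
End NullMoments.

(** * The moment equation for solutions of the wave equation *)

Section WaveMoments.
Context {R : realType} {m : nat}.
Implicit Types (psi phi : 'rV[R]_m.+2 -> R) (a x : 'rV[R]_m.+1) (t u v r : R) (k : nat).
Local Notation d0 := (partial (ord0 : 'I_m.+2)).
Local Notation ds i := (partial (lift (ord0 : 'I_m.+2) i)).

Lemma class_C1_scale n (c : R) (f : 'rV[R]_n.+1 -> R) : class_C 1 f ->
  class_C 1 (fun p => c * f p) /\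
  forall j, partial j (fun p => c * f p) = fun p => c * partial j f p.
Proof.
move=> C1; apply: class_C1_with.
- by apply: continuous_mul; [exact: continuous_const|exact: class_C_continuous C1].
- by move=> j p; apply: is_deriveZ; exact: class_C1_is_derive.
- move=> j; apply: continuous_mul; first exact: continuous_const.
  exact: class_C1_partial_continuous.
Qed.

Section Solution.
Context (phi : 'rV[R]_m.+2 -> R) (C2 : class_C 2 phi).
Context (wave0 : forall p, wave_op phi p = 0).

Let C1 : class_C 1 phi := class_C_pred _ _ _ C2.
Let C1p j : class_C 1 (partial j phi) := class_C_partial _ _ j C2.

(** [moment_divergence] for the spatial gradient, [f_j = d_j phi]. Its tangential divergence is [r]
    times the spatial Laplacian minus the second radial derivative, which the wave equation turns
    into [-4 r] times [uv_part]; its normal component is [d_r phi = d_u phi + d_v phi]. A tangential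
    first derivative remains on the right. *)
Lemma wave_moment_radial a k u v :
  m%:R * (moment a k (u_part phi) u v + moment a k (v_part phi) u v)
  + 4 * ((u + v) / 2) * moment a k (uv_part phi) u v
  = k%:R * sphere_int (fun x =>
      (\sum_j a 0 j * ds j phi (null_pt u v x) - dotr a x * radial phi u v x) * dotr a x ^+ k.-1).
Proof.
have C1f (j : 'I_m.+1) : class_C 1 (fun x => ds j phi (null_pt u v x)).
  exact: (class_C1_slice _ ((u - v) / 2) ((u + v) / 2) (C1p _)).1.
have df (i j : 'I_m.+1) x : partial i (fun x => ds j phi (null_pt u v x)) x =
    (u + v) / 2 * ds i (ds j phi) (null_pt u v x).
  by have [_ ->] := class_C1_slice _ ((u - v) / 2) ((u + v) / 2) (C1p (lift ord0 j)).
have := moment_divergence a k _ C1f.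
have -> : (fun x => (\sum_j (partial j (fun x => ds j phi (null_pt u v x)) x
    - x 0 j * \sum_i x 0 i * partial i (fun x => ds j phi (null_pt u v x)) x)) * dotr a x ^+ k)
    = (fun x => - (4 * ((u + v) / 2)) * (uv_part phi u v x * dotr a x ^+ k)).
  apply/funext => x.
  have lap : \sum_j ds j (ds j phi) (null_pt u v x) = d0 (d0 phi) (null_pt u v x).
    have := wave0 (null_pt u v x); rewrite /wave_op addrC => /eqP.
    by rewrite subr_eq0 => /eqP.
  have -> : \sum_j (partial j (fun x => ds j phi (null_pt u v x)) x
      - x 0 j * \sum_i x 0 i * partial i (fun x => ds j phi (null_pt u v x)) x)
      = (u + v) / 2 * (d0 (d0 phi) (null_pt u v x) - radial2 phi u v x).
    rewrite -lap /radial2 -sumrB big_distrr /=; apply: eq_bigr => j _.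
    rewrite df mulrBr; congr (_ - _); rewrite mulrCA; congr (_ * _).
    rewrite /radial big_distrr /=; apply: eq_bigr => i _.
    by rewrite df mulrCA.
  by rewrite /uv_part; field.
rewrite sphere_intZ; last exact/moment_integrand_continuous/uv_part_jcontinuous.
have cu := moment_integrand_continuous a k _ u v (u_part_jcontinuous _ C2).
have cv := moment_integrand_continuous a k _ u v (v_part_jcontinuous _ C2).
have -> : sphere_int (fun x => (\sum_j x 0 j * ds j phi (null_pt u v x)) * dotr a x ^+ k)
    = moment a k (u_part phi) u v + moment a k (v_part phi) u v.
  rewrite /moment -sphere_intD //; congr sphere_int; apply/funext => x.
  by rewrite /u_part /v_part -/(radial phi u v x); field.
move=> <-; rewrite -/(moment a k (uv_part phi) u v) mulNr addrAC addNr add0r.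
by [].
Qed.

(** [moment_divergence] for [f_j = a_j phi] removes the derivative left over above. As [|a| = 1],
    the correction is [k] times the moment of order [k - 1] minus that of order [k + 1]; the former
    vanishes by hypothesis, and the latter turns [m] into [m + k]. *)
Lemma wave_moment_tangential a k u v : sqnorm a = 1 ->
  (forall l, k = l.+1 -> moment a l (value_part phi) u v = 0) ->
  (u + v) / 2 * sphere_int (fun x =>
      (\sum_j a 0 j * ds j phi (null_pt u v x) - dotr a x * radial phi u v x) * dotr a x ^+ k)
  = (m + k)%:R * moment a k.+1 (value_part phi) u v.
Proof.
move=> a1 IH.
pose f (j : 'I_m.+1) x := a 0 j * phi (null_pt u v x).
have [C1s ds'] := class_C1_slice _ ((u - v) / 2) ((u + v) / 2) C1.
have C1f j : class_C 1 (f j) := (class_C1_scale _ (a 0 j) _ C1s).1.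
have df i j x : partial i (f j) x = a 0 j * ((u + v) / 2 * ds i phi (null_pt u v x)).
  by rewrite (class_C1_scale _ (a 0 j) _ C1s).2 ds'.
have cm l := moment_integrand_continuous a l _ u v (value_part_jcontinuous _ C2).
have cX : continuous (fun x =>
    (\sum_j a 0 j * ds j phi (null_pt u v x) - dotr a x * radial phi u v x) * dotr a x ^+ k).
  apply: continuous_mul; last exact: dotr_pow_continuous.
  apply: continuous_add.
    apply: continuous_sum => j; apply: continuous_mul; first exact: continuous_const.
    apply: (jcontinuous_slice (fun u v x => ds j phi (null_pt u v x)) u v).
    by apply: null_jcontinuous; exact: class_C_continuous (C1p _).
  apply/continuous_opp/continuous_mul; first exact: dotr_continuous.
  by apply: jcontinuous_slice; exact: radial_jcontinuous.
have := moment_divergence a k f C1f.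
have sumxf x : \sum_j x 0 j * f j x = dotr a x * phi (null_pt u v x).
  by rewrite /dotr big_distrl /=; apply: eq_bigr => j _; rewrite /f; ring.
have sumaf x : \sum_j a 0 j * f j x = phi (null_pt u v x).
  rewrite -[RHS]mul1r -a1 /sqnorm big_distrl /=; apply: eq_bigr => j _.
  by rewrite /f; ring.
have -> : (fun x => (\sum_j (partial j (f j) x - x 0 j * \sum_i x 0 i * partial i (f j) x))
      * dotr a x ^+ k) = (fun x => (u + v) / 2 *
    ((\sum_j a 0 j * ds j phi (null_pt u v x) - dotr a x * radial phi u v x) * dotr a x ^+ k)).
  apply/funext => x; rewrite mulrA; congr (_ * _).
  rewrite /dotr big_distrl -sumrB big_distrr /=; apply: eq_bigr => j _.
  have -> : \sum_i x 0 i * partial i (f j) x = a 0 j * ((u + v) / 2 * radial phi u v x).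
    rewrite /radial !big_distrr /=; apply: eq_bigr => i _; rewrite df.
    by ring.
  by rewrite df; ring.
have -> : sphere_int (fun x => (\sum_j x 0 j * f j x) * dotr a x ^+ k)
    = moment a k.+1 (value_part phi) u v.
  congr sphere_int; apply/funext => x; rewrite sumxf exprS /value_part; ring.
rewrite sphere_intZ //.
have tail : k%:R * sphere_int (fun x => (\sum_j a 0 j * f j x - dotr a x * \sum_j x 0 j * f j x)
    * dotr a x ^+ k.-1) = - (k%:R * moment a k.+1 (value_part phi) u v).
  case: k IH {cX} => [|l] IH; first by rewrite !mul0r oppr0.
  rewrite -mulrN; congr (_ * _) => /=.
  transitivity (moment a l (value_part phi) u v - moment a l.+2 (value_part phi) u v).
    rewrite /moment -sphere_intB //; congr sphere_int; apply/funext => x.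
    by rewrite sumxf sumaf /value_part !exprS; ring.
  by rewrite IH // sub0r.
rewrite tail => /eqP; rewrite subr_eq => /eqP ->.
by rewrite natrD mulrDl.
Qed.

(** The moment equation divided by 4, with space dimension [m + 1], [r = (u + v) / 2], and the
    moment of order [k - 2] already dropped. For [k = 0] the factor [k] removes the tangential term,
    so [k.-1] does no harm. *)
Lemma wave_moment a k u v : sqnorm a = 1 -> 0 < u + v ->
  (forall l, k = l.+2 -> moment a l (value_part phi) u v = 0) ->
  moment a k (uv_part phi) u v =
    (k%:R * (m + k.-1)%:R / (u + v) ^+ 2) * moment a k (value_part phi) u v
    - m%:R / (2 * (u + v))
      * (moment a k (u_part phi) u v + moment a k (v_part phi) u v).
Proof.
move=> a1 r0 IH; have := wave_moment_radial a k u v.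
have un : u + v != 0 by rewrite gt_eqF.
case: k IH => [|l] IH; last first.
  have := wave_moment_tangential a l u v a1 => /(_ _)/= tang.
  have {tang} tang := tang (fun l' e => IH l' (congr1 S e)).
  move: (sphere_int _) tang => X tang.
  have {tang} -> : X = (m + l)%:R * moment a l.+1 (value_part phi) u v / ((u + v) / 2).
    by rewrite -tang; field.
  move: (moment _ _ (value_part phi) _ _) (moment _ _ (u_part phi) _ _)
    (moment _ _ (v_part phi) _ _) (moment _ _ (uv_part phi) _ _) => M Mu Mv W /= E.
  have -> : W = (4 * ((u + v) / 2) * W) / (2 * (u + v)) by field.
  have -> : 4 * ((u + v) / 2) * W = l.+1%:R * ((m + l)%:R * M / ((u + v) / 2)) - m%:R * (Mu + Mv).
    by rewrite -E; ring.
  by field.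
rewrite mul0r => E; move: E.
move: (moment _ _ (u_part phi) _ _)
    (moment _ _ (v_part phi) _ _) (moment _ _ (uv_part phi) _ _) => Mu Mv W E.
have -> : W = (4 * ((u + v) / 2) * W) / (2 * (u + v)) by field.
have -> : 4 * ((u + v) / 2) * W = 0 - m%:R * (Mu + Mv) by rewrite -E; ring.
by field.
Qed.

End Solution.
End WaveMoments.
(** * Moments determine a function on the sphere *)

Section MomentsDetermine.
Context {R : realType} {m : nat}.
Implicit Types (a x : 'rV[R]_m.+1) (f : 'rV[R]_m.+1 -> R) (k : nat).

Lemma bernoulli (d : R) k : 0 <= d -> 1 + k%:R * d <= (1 + d) ^+ k.
Proof.
move=> d0; elim: k => [|k IH]; first by rewrite mul0r addr0 expr0.
rewrite exprS; apply: (@le_trans _ _ ((1 + d) * (1 + k%:R * d))).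
  rewrite -subr_ge0 -natr1.
  have -> : (1 + d) * (1 + k%:R * d) - (1 + (k%:R + 1) * d) = k%:R * (d * d) by ring.
  by rewrite !mulr_ge0.
by rewrite ler_wpM2l //; lra.
Qed.

Lemma sqnorm_sub a x : sqnorm a = 1 -> sqnorm x = 1 -> sqnorm (x - a) = 2 - 2 * dotr a x.
Proof.
move=> a1 x1; transitivity (sqnorm x + sqnorm a - 2 * dotr a x); last by rewrite a1 x1.
rewrite /sqnorm /dotr big_distrr -!big_split -sumrB /=.
by apply: eq_bigr => i _; rewrite !mxE; ring.
Qed.

Lemma dotr_self a : sqnorm a = 1 -> dotr a a = 1.
Proof. by move=> <-; apply: eq_bigr => i _; rewrite expr2. Qed.

Lemma dotr_ge a x : sqnorm a = 1 -> sqnorm x = 1 -> -1 <= dotr a x.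
Proof.
move=> a1 x1; have := sqnorm_ge0 (x - - a).
rewrite sqnorm_sub //; last by rewrite -scaleN1r sqnormZ a1 sqrrN expr1n mul1r.
rewrite (_ : dotr (- a) x = - dotr a x); first lra.
by rewrite /dotr -sumrN; apply: eq_bigr => i _; rewrite mxE mulNr.
Qed.

Lemma dotr_le a x : sqnorm a = 1 -> sqnorm x = 1 -> dotr a x <= 1.
Proof. by move=> a1 x1; have := sqnorm_ge0 (x - a); rewrite sqnorm_sub //; lra. Qed.

(* Weighting by powers of [(1 + a.x) / (2 - d)] concentrates at [a]. *)
Lemma moments_not_pos f a : continuous f -> sqnorm a = 1 ->
  (forall k, sphere_int (fun x => f x * dotr a x ^+ k) = 0) -> f a <= 0.
Proof.
move=> cf a1 mom0; rewrite leNgt; apply/negP => fa.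
pose al := f a / 2; have al0 : 0 < al by rewrite divr_gt0.
have [d [d0 d1 dP]] : exists d, [/\ 0 < d, d <= 1 &
    forall x, sqnorm x = 1 -> 1 - d < dotr a x -> al <= f x].
  have /cvgrPdist_lt /(_ _ al0) /nbhs_ballP[e /= e0 He] := cf a.
  (* On the cap [a.x > 1 - d] one has [|x - a|^2 = 2 - 2 a.x < 2 d <= (e / 2)^2], so [x] is within
     [e] of [a]. The bound [d <= 1] keeps [2 - d] positive. *)
  exists (Num.min 1 (e ^+ 2 / 8)); split.
  - by rewrite lt_min ltr01 divr_gt0 // exprn_gt0.
  - by rewrite ge_min lexx.
  move=> x x1 sx.
  have sx' : 2 - 2 * dotr a x <= (e / 2) ^+ 2.
    have : Num.min 1 (e ^+ 2 / 8) <= e ^+ 2 / 8 by rewrite ge_min lexx orbT.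
    rewrite exprMn; move: (Num.min _ _) sx => q h1 h2; lra.
  have xa : ball a e x.
    rewrite -ball_normE /= distrC; apply: (@le_lt_trans _ _ (e / 2)); last by lra.
    apply: row_norm_le => [|j]; first by lra.
    rewrite -(ler_pXn2r (n := 2)) ?nnegrE //; last by lra.
    rewrite real_normK ?num_real //; apply: le_trans sx'.
    by rewrite -sqnorm_sub //; exact: coord_sq_le.
  have := He _ xa; rewrite ltr_norml /al => /andP[_]; lra.
have d2 : 0 < 2 - d by lra.
(* A continuous substitute for the indicator of the smaller cap [a.x > 1 - d/2]; on the sphere it is
   at most [d/2 <= 1]. *)
pose chi x := pos (dotr a x - (1 - d / 2)).
have cs := dotr_continuous a.
have cchi : continuous chi.
  apply: (continuous_compose _ _ _ (fun x => dotr a x - (1 - d / 2)) _ _ pos_continuous).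
  by apply: continuous_add => //; exact: continuous_const.
have chi_int : 0 < sphere_int chi.
  apply: (sphere_int_gt0 _ a) => // [x _|]; first exact: pos_ge0.
  by rewrite /chi dotr_self // pos_id; lra.
(* On the smaller cap [(1 + a.x) / (2 - d)] is at least [(2 - d/2) / (2 - d) = 1 + del]. *)
pose del := d / 2 / (2 - d); have del0 : 0 < del by rewrite !divr_gt0.
(* The shift by 1 makes the base nonnegative on the sphere and singles out [a], whereas even powers
   of [a.x] would also peak at [-a]. By the binomial formula [g k] is a combination of moments. *)
pose g k x := f x * ((1 + dotr a x) / (2 - d)) ^+ k.
have cg k : continuous (g k).
  apply: continuous_mul => //; apply: continuous_pow; apply: continuous_mul.
    by apply: continuous_add => //; exact: continuous_const.
  exact: continuous_const.
have g0 k : sphere_int (g k) = 0.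
  have -> : g k = fun x => \sum_(i < k.+1) (((2 - d)^-1 ^+ k * 'C(k, i)%:R) * (f x * dotr a x ^+ i)).
    apply/funext => x; rewrite /g exprMn exprDn big_distrl big_distrr /=.
    apply: eq_bigr => i _; by rewrite expr1n mul1r -[_ *+ 'C(k, i)]mulr_natr; ring.
  have cfi i : continuous (fun x => f x * dotr a x ^+ i).
    by apply: continuous_mul => //; exact: continuous_pow.
  rewrite sphere_int_sum => [|i]; last by apply: continuous_mul => //; exact: continuous_const.
  by rewrite big1 // => i _; rewrite sphere_intZ // mom0 mulr0.
have cnf : continuous (fun x => `|f x|).
  exact: (continuous_compose _ _ _ _ _ cf (@norm_continuous _ _)).
(* Three regions: off the large cap the base is at most 1, so [g k >= -|f|]; between the caps
   [g k >= 0]; on the small cap [g k] grows geometrically. *)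
have low k x : sqnorm x = 1 -> al * (1 + del) ^+ k * chi x - `|f x| <= g k x.
  move=> x1; have s1 := dotr_ge a x a1 x1; have s2 := dotr_le a x a1 x1.
  have q0 : 0 <= (1 + dotr a x) / (2 - d) by rewrite divr_ge0 //; lra.
  have nf := normr_ge0 (f x).
  have [sd|sd] := leP (dotr a x) (1 - d).
    rewrite /chi pos_eq0; last lra.
    rewrite mulr0 sub0r; apply: (@le_trans _ _ (- `|g k x|)); last by rewrite lerNl -normrN ler_norm.
    rewrite lerN2 /g normrM (ger0_norm (exprn_ge0 _ q0)) ler_piMr //.
    by rewrite exprn_ile1 // ler_pdivrMr // mul1r; lra.
  have fx := dP x x1 sd.
  have f0 : 0 <= f x by lra.
  have [sd2|sd2] := leP (dotr a x) (1 - d / 2).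
    rewrite /chi pos_eq0; last lra.
    rewrite mulr0 sub0r; apply: (@le_trans _ _ 0); first by rewrite oppr_le0.
    by rewrite mulr_ge0 // exprn_ge0.
  apply: (@le_trans _ _ (al * (1 + del) ^+ k * 1)).
    rewrite lerBlDr; apply: (@le_trans _ _ (al * (1 + del) ^+ k * 1)); last by rewrite lerDl.
    apply: ler_wpM2l; last by rewrite /chi pos_id; lra.
    apply: mulr_ge0; first exact: ltW.
    by apply: exprn_ge0; lra.
  rewrite mulr1; apply: ler_pM => //; first exact: ltW.
    by rewrite exprn_ge0 //; lra.
  apply: lerXn2r; rewrite ?nnegrE //; first by lra.
  rewrite ler_pdivlMr // /del.
  have -> : (1 + d / 2 / (2 - d)) * (2 - d) = 2 - d / 2 by field; rewrite gt_eqF.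
  lra.
have X0 : 0 <= sphere_int (fun x => `|f x|) by apply: sphere_int_ge0.
move: X0 chi_int low; set Y := sphere_int (fun x => `|f x|); set X := sphere_int chi => Y0 X0 low.
have main k : al * (1 + del) ^+ k * X <= Y.
  rewrite -subr_le0 -(g0 k) -sphere_intZ // -sphere_intB //; last first.
    by apply: continuous_mul => //; exact: continuous_const.
  apply: sphere_int_le => //; last by move=> x; exact: low.
  apply: continuous_add; last exact: continuous_opp.
  by apply: continuous_mul => //; exact: continuous_const.
have aX : 0 < al * X * del by apply: mulr_gt0 => //; exact: mulr_gt0.
(* [main] bounds a geometric sequence by [Y]; its linear minorant from [bernoulli] already exceeds
   [Y] at this [N]. *)
have [N YN] : exists N, Y / (al * X * del) < N%:R.
  by exists (Num.bound (Y / (al * X * del))); apply: archi_boundP; rewrite divr_ge0 // ltW.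
move: YN; rewrite ltr_pdivrMr // ltNge => /negP; apply.
apply: le_trans (main N); rewrite (_ : al * _ * X = al * X * (1 + del) ^+ N); last by ring.
rewrite mulrCA; apply: ler_wpM2l; first by apply: mulr_ge0; exact: ltW.
by apply: le_trans (bernoulli del N (ltW del0)); rewrite lerDr.
Qed.

Lemma moments_determine f a : continuous f -> sqnorm a = 1 ->
  (forall k, sphere_int (fun x => f x * dotr a x ^+ k) = 0) -> f a = 0.
Proof.
move=> cf a1 mom0; apply/eqP; rewrite eq_le (moments_not_pos f a) //=.
rewrite -oppr_le0 (moments_not_pos (fun x => - f x) a) //.
  exact: continuous_opp.
move=> k; rewrite (_ : (fun x => _) = (fun x => -1 * (f x * dotr a x ^+ k))); last first.
  by apply/funext => x; ring.
rewrite sphere_intZ ?mom0 ?mulr0 //.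
by apply: continuous_mul => //; exact: dotr_pow_continuous.
Qed.

End MomentsDetermine.

(** * Characteristic data and vanishing of the moments on D *)

Section Vanishing.
Context {R : realType} {m : nat}.
Implicit Types (a x : 'rV[R]_m.+1) (t u v : R) (k : nat) (p : 'rV[R]_m.+2).

(** Passes from zero data of a moment on a characteristic line to its derivative along that line. *)
Lemma derive_locally_zero (f : R -> R) (b c x d : R) : is_derive x 1 f d ->
  b < x < c -> (forall y, b < y < c -> f y = 0) -> d = 0.
Proof.
move=> [_ <-] xI f0; rewrite -[RHS](derive_cst (V := R) (W := R) (0 : R) x 1).
apply: near_eq_derive.
have : \forall y \near x, y \in `]b, c[ by apply: near_in_itvoo; rewrite in_itv.
by apply: filterS => y; rewrite in_itv /= => /f0.
Qed.

Lemma radius_spacetime_pt t x : Defs.radius (spacetime_pt t x) = Num.sqrt (sqnorm x).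
Proof.
by congr Num.sqrt; apply: eq_bigr => i _; rewrite /xcoord spacetime_ptS.
Qed.

Lemma radius_null_pt u v x : 0 <= u + v -> sqnorm x = 1 ->
  Defs.radius (null_pt u v x) = (u + v) / 2.
Proof.
by move=> uv x1; rewrite radius_spacetime_pt sqnormZ x1 mulr1 sqrtr_sqr ger0_norm // divr_ge0.
Qed.

Lemma tcoord_null_pt u v x : tcoord (null_pt u v x) = (u - v) / 2.
Proof. exact: spacetime_pt0. Qed.

Lemma null_pt_coords p : 0 < Defs.radius p ->
  exists2 x, sqnorm x = 1 & p = null_pt (ucoord p) (vcoord p) x.
Proof.
move=> r0; pose y : 'rV[R]_m.+1 := \row_i xcoord p i.
have ysq : sqnorm y = Defs.radius p ^+ 2.
  rewrite /Defs.radius sqr_sqrtr; first by apply: eq_bigr => i _; rewrite mxE.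
  by apply: sumr_ge0 => i _; exact: sqr_ge0.
exists ((Defs.radius p)^-1 *: y).
  by rewrite sqnormZ ysq exprVn mulVf // expf_neq0 // gt_eqF.
rewrite /null_pt /ucoord /vcoord.
have -> : (Defs.radius p + tcoord p - (Defs.radius p - tcoord p)) / 2 = tcoord p by field.
have -> : (Defs.radius p + tcoord p + (Defs.radius p - tcoord p)) / 2 = Defs.radius p by field.
rewrite scalerA divff ?gt_eqF // scale1r; apply/rowP => j.
have [i ->|->] := unliftP ord0 j; first by rewrite spacetime_ptS mxE.
by rewrite spacetime_pt0.
Qed.

Context (phi : 'rV[R]_m.+2 -> R) (eps L : R) (C2 : class_C 2 phi).
Context (wave0 : forall p, wave_op phi p = 0).
Context (cone0 : forall p, truncated_cone eps L p -> phi p = 0).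
Context (eps0 : 0 < eps) (epsL : eps <= L).

Lemma moment_eq0 (F : R -> R -> 'rV[R]_m.+1 -> R) a k u v :
  (forall x, sqnorm x = 1 -> F u v x = 0) -> moment a k F u v = 0.
Proof.
by move=> F0; rewrite -[RHS](@sphere_int0 R m); apply: sphere_int_ext => x /F0 ->; rewrite mul0r.
Qed.

(** The line [v = 1] is the half [t >= 0] of the cone: [t = (u - 1) / 2 < L] and [r = t + 1]. *)
Lemma moment_value_v1 a k u : 1 <= u < 2 * L + 1 -> moment a k (value_part phi) u 1 = 0.
Proof.
have e0 := eps0; move=> uI; apply: moment_eq0 => x x1; apply: cone0; split.
  by rewrite radius_null_pt // ?tcoord_null_pt ?ger0_norm; lra.
by rewrite tcoord_null_pt; lra.
Qed.

(** The line [u = 1] is the half [t <= 0]: [t = (1 - v) / 2 > -eps] and [r = 1 - t]. *)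
Lemma moment_value_u1 a k v : 1 <= v < 1 + 2 * eps -> moment a k (value_part phi) 1 v = 0.
Proof.
have [e0 eL] := (eps0, epsL); move=> vI; apply: moment_eq0 => x x1; apply: cone0; split.
  by rewrite radius_null_pt // ?tcoord_null_pt ?ler0_norm; lra.
by rewrite tcoord_null_pt; lra.
Qed.

(** Both denominators are at least 1 when [u + v >= 2], so they can simply be dropped to get the
    Goursat constant. *)
Lemma wave_bound (k u v M Mu Mv : R) (q : R) : 0 <= k -> 0 <= q -> 2 <= u + v ->
  `|k * q / (u + v) ^+ 2 * M - m%:R / (2 * (u + v)) * (Mu + Mv)|
    <= (k * q + m%:R) * (`|M| + `|Mu| + `|Mv|).
Proof.
move=> k0 q0 uv; have m0 : 0 <= m%:R :> R by [].
have kq0 : 0 <= k * q by exact: mulr_ge0.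
have r1 : 1 <= 2 * (u + v) by lra.
have sq1 : 1 <= (u + v) ^+ 2 by apply: exprn_ege1; lra.
have coeff (c d : R) : 0 <= c -> c <= k * q + m%:R -> 1 <= d -> `|c / d| <= k * q + m%:R.
  move=> c0 cK d1; have d0 : 0 < d by apply: lt_le_trans d1.
  rewrite ger0_norm; last by rewrite divr_ge0 // ltW.
  by rewrite ler_pdivrMr // (le_trans cK) // ler_peMr // addr_ge0.
apply: (le_trans (ler_normB _ _)).
rewrite (normrM (k * q / _)) (normrM (m%:R / _)) -addrA [leRHS]mulrDr.
apply: lerD; apply: ler_pM => //; first by apply: coeff; rewrite ?lerDl.
- by apply: coeff; rewrite ?lerDr.
- exact: ler_normD.
Qed.

Lemma moments_vanish a k u0 v0 : sqnorm a = 1 ->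
  1 < u0 < 2 * L + 1 -> 1 < v0 < 1 + 2 * eps -> moment a k (value_part phi) u0 v0 = 0.
Proof.
(* The point is generalized in the induction because the equation of order [k] needs the lower
   moments on the whole rectangle below [(u0, v0)]. Stopping at [(u0, v0)] keeps this rectangle
   inside D. *)
move=> a1; elim/ltn_ind: k u0 v0 => k IH u0 v0 /andP[u01 u0L] /andP[v01 v0e].
have cM := value_part_jcontinuous _ C2.
have cMu := u_part_jcontinuous _ C2.
have cMv := v_part_jcontinuous _ C2.
have cW := uv_part_jcontinuous _ C2.
have C1 := class_C_pred _ _ _ C2.
pose M := moment a k (value_part phi); pose Mu := moment a k (u_part phi).
pose Mv := moment a k (v_part phi); pose W := moment a k (uv_part phi).
have dMu : forall u v, is_derive u 1 (M^~ v) (Mu u v).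
  by apply: moment_derive_u => // u v x; exact: is_derive_u.
have dMv : forall u v, is_derive v 1 (M u) (Mv u v).
  by apply: moment_derive_v => // u v x; exact: is_derive_v.
have dWv : forall u v, is_derive v 1 (Mu u) (W u v).
  by apply: moment_derive_v => // u v x; exact: u_part_derive_v.
have dWu : forall u v, is_derive u 1 (Mv^~ v) (W u v).
  by apply: moment_derive_u => // u v x; exact: v_part_derive_u.
have [B1 B10 HB1] := bounded_on_rectangle _ 1 u0 1 v0 (moment_continuous a k _ cM).
have [B2 B20 HB2] := bounded_on_rectangle _ 1 u0 1 v0 (moment_continuous a k _ cMu).
have [B3 B30 HB3] := bounded_on_rectangle _ 1 u0 1 v0 (moment_continuous a k _ cMv).
apply: (goursat_uniqueness M Mu Mv W u0 v0 (k%:R * (m + k.-1)%:R + m%:R) (B1 + B2 + B3)) => //.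
- by apply: addr_ge0 => //; exact: addr_ge0.
- by move=> v vI; apply: moment_value_u1; lra.
- move=> u uI; apply: (derive_locally_zero _ 1 (2 * L + 1) u _ (dMu u 1)); first lra.
  by move=> y yI; apply: moment_value_v1; lra.
- move=> v vI; apply: (derive_locally_zero _ 1 (1 + 2 * eps) v _ (dMv 1 v)); first lra.
  by move=> y yI; apply: moment_value_u1; lra.
- move=> u v uI vI.
  rewrite /W (wave_moment _ C2 wave0) //; [|lra|].
    by apply: wave_bound => //; lra.
  by move=> l kl; apply: IH; rewrite ?kl //; lra.
- move=> u v uI vI.
  have h1 : `|M u v| <= B1 by apply: HB1; lra.
  have h2 : `|Mu u v| <= B2 by apply: HB2; lra.
  have h3 : `|Mv u v| <= B3 by apply: HB3; lra.
  by move: h1 h2 h3; split; lra.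
- by rewrite u01 lexx.
- by rewrite v01 lexx.
Qed.

End Vanishing.

Theorem theorem1p2 (R : realType) (n : nat) (eps L : R)
    (phi : 'rV[R]_n.+1 -> R) :
  (1 <= n)%N -> 0 < eps -> eps <= L ->
  class_C 2 phi ->
  (forall p, wave_op phi p = 0) ->
  (forall p, truncated_cone eps L p -> phi p = 0) ->
  forall p, cone_domain eps L p -> phi p = 0.
Proof.
case: n phi => [//|m] phi _ eps0 epsL C2 wave0 cone0 p [uI vI].
(* [r = (u + v) / 2 > 1], so [p] has a direction; that direction is the [a] whose moments are used,
   and it is also where they are evaluated. *)
have r0 : 0 < Defs.radius p by move: uI vI; rewrite /ucoord /vcoord; lra.
have [a a1 pE] := null_pt_coords p r0; rewrite pE.
apply: (moments_determine (value_part phi (ucoord p) (vcoord p)) a) => //.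
  exact/jcontinuous_slice/value_part_jcontinuous.
by move=> k; apply: (moments_vanish phi eps L C2 wave0 cone0).
Qed.
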